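(* Let $(M,g)$ be a three-dimensional Lorentzian manifold with a null congruence $c$, let $S$ be its trace-free Ricci tensor, and suppose that $\mathrm{bo}_c(\nabla^mS)\le0$ on $M$ for all $0\le m\le3$ (i.e. these tensors are of aligned type II or more special with respect to $c$). Let $\Gamma\subset M$ be the set of points at which $S$ is non-zero. Then $c$ has the Kundt property at every point of the closure $\bar\Gamma$.
   Context: Lorentzian metrics have signature $(-,+,\dots,+)$ and $\nabla$ is the Levi-Civita connection. A null congruence $c$ (equivalently null line distribution) is a smooth rank-one subbundle of $TM$ whose fibres are null lines. With $k$ a local non-vanishing section of $c$, $c$ has the Kundt property at a point if $X^a\nabla_ak^b\propto k^b$ at that point for all $X\in c^\perp$, equivalently $k_{[a}\nabla_{b]}k_{[c}k_{d]}=0$ there. Boost order: at each point of an $n$-dimensional Lorentzian manifold take a null frame $\{e_0,e_1,e_i\}=\{k,l,m_i\}$ ($2\le i\le n-1$) with $0\ne k\in c$, whose only non-zero inner products are $g(k,l)=g(m_i,m_i)=1$. The boost weight of a multi-index $\alpha_1\cdots\alpha_r$ is (number of $0$'s) minus (number of $1$'s). The boost order $\mathrm{bo}_c(T)$ of a non-zero covariant tensor $T$ is the largest boost weight of a multi-index with $T_{\alpha_1\cdots\alpha_r}=T(e_{\alpha_1},\dots,e_{\alpha_r})\ne0$ (independent of the frame); the zero tensor is regarded as having boost order $\le s$ for every $s$. *)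

(* Defs.v *)
From HB Require Import structures.
From mathcomp Require Import all_boot all_order all_algebra.
From mathcomp Require Import all_classical all_reals all_analysis.
Set Implicit Arguments.
Unset Strict Implicit.
Unset Printing Implicit Defensive.
Import Order.TTheory GRing.Theory Num.Theory.
Import numFieldNormedType.Exports.
Local Open Scope classical_set_scope.
Local Open Scope ring_scope.

Section Calculus.
Context {R : realType} {n : nat}.

Definition partial {W : normedModType R} (a : 'I_n) (f : 'rV[R]_n -> W)
  : 'rV[R]_n -> W := fun x => 'D_(delta_mx 0 a) f x.

(* C^oo, for an open U: a function all of whose iterated partial derivatives
   are differentiable (hence continuous). *)
Definition smooth_on {W : normedModType R} (U : set 'rV[R]_n)
    (f : 'rV[R]_n -> W) : Prop :=
  forall (s : seq 'I_n) (x : 'rV[R]_n), U x -> differentiable (foldr partial f s) x.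

End Calculus.

Section Manifold.
Context {R : realType}.

(* ch_inv is only meaningful on the image of the chart. *)
Record chart (M : topologicalType) (n : nat) := Chart {
  ch_dom : set M;
  ch_map : M -> 'rV[R]_n;
  ch_inv : 'rV[R]_n -> M;
  ch_dom_open : open ch_dom;
  ch_img_open : open (ch_map @` ch_dom);
  ch_mapK : forall p, ch_dom p -> ch_inv (ch_map p) = p;
  ch_map_cont : forall p, ch_dom p -> {for p, continuous ch_map};
  ch_inv_cont : forall x, (ch_map @` ch_dom) x -> {for x, continuous ch_inv}
}.

Definition ch_img M n (u : chart M n) : set 'rV[R]_n := ch_map u @` ch_dom u.

Definition transition M n (u v : chart M n) : 'rV[R]_n -> 'rV[R]_n :=
  ch_map v \o ch_inv u.

Definition overlap M n (u v : chart M n) : set 'rV[R]_n :=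
  ch_map u @` (ch_dom u `&` ch_dom v).

Record manifold (n : nat) := Manifold {
  mf_carrier :> topologicalType;
  mf_hausdorff : hausdorff_space mf_carrier;
  mf_second_countable : @second_countable mf_carrier;
  mf_index : Type;
  mf_chart : mf_index -> chart mf_carrier n;
  mf_cover : forall p, exists i, ch_dom (mf_chart i) p;
  mf_smooth : forall i j,
    smooth_on (overlap (mf_chart i) (mf_chart j))
              (transition (mf_chart i) (mf_chart j))
}.

End Manifold.
Arguments chart R M n : clear implicits.
Arguments manifold R n : clear implicits.

(* Geometry in one coordinate chart: G x is the Gram matrix of the metric in the
   coordinate basis at the coordinate point x. Tangent vectors are row vectors. *)
Section Local.
Context {R : realType} {n : nat}.
Implicit Types (G : 'rV[R]_n -> 'M[R]_n) (x : 'rV[R]_n).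

Definition minkowski : 'M[R]_n :=
  \matrix_(i, j) (if i == j then (if i == 0%N :> nat then -1 else 1) else 0).

(* The rows of P form an orthonormal basis of signature (-,+,...,+). *)
Definition lorentzian (A : 'M[R]_n) : Prop :=
  exists2 P : 'M[R]_n, P \in unitmx & P *m A *m P^T = minkowski.

Definition inner (A : 'M[R]_n) (v w : 'rV[R]_n) : R := (v *m A *m w^T) 0 0.

(* Gamma^c_{ab} of the Levi-Civita connection *)
Definition christoffel G x (c a b : 'I_n) : R :=
  2^-1 * \sum_d invmx (G x) c d *
    (partial a (fun y => G y b d) x + partial b (fun y => G y a d) x
     - partial d (fun y => G y a b) x).

(* R^d_{cab}, with R(X,Y)Z = nabla_X nabla_Y Z - nabla_Y nabla_X Z - nabla_[X,Y] Z
   and (R(X,Y)Z)^d = R^d_{cab} Z^c X^a Y^b *)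
Definition riemann G x (d c a b : 'I_n) : R :=
  partial a (fun y => christoffel G y d b c) x
  - partial b (fun y => christoffel G y d a c) x
  + \sum_e (christoffel G x d a e * christoffel G x e b c
            - christoffel G x d b e * christoffel G x e a c).

Definition ricci G x : 'M[R]_n :=
  \matrix_(a, b) \sum_d riemann G x d a d b.

Definition scalar_curvature G x : R :=
  \sum_a \sum_b invmx (G x) a b * ricci G x a b.

(* nabla_X k for a vector field k *)
Definition nabla_vec G (k : 'rV[R]_n -> 'rV[R]_n) x (X : 'rV[R]_n) : 'rV[R]_n :=
  'D_X k x + \row_b \sum_a \sum_c christoffel G x b a c * X 0 a * k x 0 c.

Definition tensor (r : nat) : Type := r.-tuple 'I_n -> R.

Definition tensor_field (r : nat) : Type := 'rV[R]_n -> tensor r.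

Definition tracefree_ricci G : tensor_field 2 := fun x al =>
  let i := tnth al ord0 in let j := tnth al ord_max in
  ricci G x i j - scalar_curvature G x / n%:R * G x i j.

Definition set_index r (al : r.-tuple 'I_n) (j : 'I_r) (c : 'I_n)
  : r.-tuple 'I_n := [tuple if i == j then c else tnth al i | i < r].

(* The differentiation index comes first:
   (nabla T)_{a al} = d_a T_al - sum_j Gamma^c_{a al_j} T_{al[j := c]}. *)
Definition nabla G r (T : tensor_field r) : tensor_field r.+1 := fun x al =>
  let a := thead al in
  let be : r.-tuple 'I_n := [tuple of behead al] in
  partial a (fun y => T y be) x
  - \sum_j \sum_c christoffel G x c a (tnth be j) * T x (set_index be j c).

Fixpoint iter_nabla G r (T : tensor_field r) (m : nat) : tensor_field (m + r) :=
  match m return tensor_field (m + r) with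
  | 0 => T
  | m'.+1 => nabla G (@iter_nabla G r T m')
  end.

(* Row a of e is the frame vector e_a; the rows 0, 1, i >= 2 are k, l, m_i. *)
Definition null_gram : 'M[R]_n :=
  \matrix_(i, j) (if ((i == 0%N :> nat) && (j == 1%N :> nat))
                     || ((i == 1%N :> nat) && (j == 0%N :> nat))
                     || ((2 <= i)%N && (i == j)) then 1 else 0).

Definition null_frame (A e : 'M[R]_n) : Prop := e *m A *m e^T = null_gram.

(* T(e_{al_1}, ..., e_{al_r}) *)
Definition frame_component r (T : tensor r) (e : 'M[R]_n) : tensor r := fun al =>
  \sum_(be : r.-tuple 'I_n) T be * \prod_j e (tnth al j) (tnth be j).

Definition boost_weight r (al : r.-tuple 'I_n) : int :=
  (count (fun i : 'I_n => i == 0%N :> nat) al)%:Z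
  - (count (fun i : 'I_n => i == 1%N :> nat) al)%:Z.

(* The zero tensor has boost order -oo. *)
Definition boost_order r (T : tensor r) (e : 'M[R]_n) : \bar int :=
  \big[maxe/-oo%E]_(al : r.-tuple 'I_n | frame_component T e al != 0)
    (boost_weight al)%:E.

End Local.
Arguments nabla {R n} G {r} T.
Arguments iter_nabla {R n} G {r} T m.
Arguments tracefree_ricci {R n} G.

Section LorentzianManifold.
Context {R : realType} {n : nat}.

Record lorentz_metric (M : manifold R n) := LorentzMetric {
  lm_gram : mf_index M -> 'rV[R]_n -> 'M[R]_n;
  lm_smooth : forall i, smooth_on (ch_img (mf_chart i)) (lm_gram i);
  lm_change : forall i j x, overlap (mf_chart i) (mf_chart j) x ->
    let phi := transition (mf_chart i) (mf_chart j) in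
    lm_gram i x = 'J phi x *m lm_gram j (phi x) *m ('J phi x)^T;
  lm_lorentzian : forall i x, ch_img (mf_chart i) x -> lorentzian (lm_gram i x)
}.

(* C is the fibre map of a line distribution, U an open set of coordinate points. *)
Definition local_section (C : 'rV[R]_n -> set 'rV[R]_n) (U : set 'rV[R]_n)
    (k : 'rV[R]_n -> 'rV[R]_n) : Prop :=
  smooth_on U k /\ forall x, U x -> k x != 0 /\ C x (k x).

(* The fibres nc_fibre i x, which contain the zero vector, are lines spanned
   near every point by a smooth non-vanishing section. *)
Record null_congruence (M : manifold R n) (g : lorentz_metric M) := NullCongruence {
  nc_fibre : mf_index M -> 'rV[R]_n -> set 'rV[R]_n;
  nc_change : forall i j x, overlap (mf_chart i) (mf_chart j) x ->
    let phi := transition (mf_chart i) (mf_chart j) in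
    forall v, nc_fibre i x v <-> nc_fibre j (phi x) (v *m 'J phi x);
  nc_line : forall i x, ch_img (mf_chart i) x ->
    exists U k, [/\ open U, U x, U `<=` ch_img (mf_chart i),
      local_section (nc_fibre i) U k &
      forall y, U y -> nc_fibre i y = [set v | exists t : R, v = t *: k y]];
  nc_null : forall i x v, ch_img (mf_chart i) x -> nc_fibre i x v ->
    inner (lm_gram g i x) v v = 0
}.

(* A tensor on M is given by its components in each chart. *)
Definition mf_tensor (M : manifold R n) (r : nat) : Type :=
  mf_index M -> @tensor_field R n r.

(* nabla^m S *)
Definition nabla_tracefree_ricci (M : manifold R n) (g : lorentz_metric M)
    (m : nat) : mf_tensor M (m + 2) :=
  fun i => iter_nabla (lm_gram g i) (tracefree_ricci (lm_gram g i)) m.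

Context {M : manifold R n} {g : lorentz_metric M}.

(* Properties of T at p are required in every chart around p; by the tensor
   transformation law the choice of chart is immaterial. *)

(* bo_c(T) <= s at p; the boost order does not depend on the frame. The condition
   on e says that k = e_0 lies in c (k is non-zero since g(k,l) = 1). *)
Definition boost_order_le (c : null_congruence g) r (T : mf_tensor M r) (s : int)
    (p : M) : Prop :=
  forall i, ch_dom (mf_chart i) p ->
    let x := ch_map (mf_chart i) p in
    forall e : 'M[R]_n, null_frame (lm_gram g i x) e ->
      (forall a : 'I_n, a = 0%N :> nat -> nc_fibre c i x (row a e)) ->
      (boost_order (T i x) e <= s%:E)%E.

Definition nonzero_at r (T : mf_tensor M r) (p : M) : Prop :=
  forall i, ch_dom (mf_chart i) p ->
    exists al, T i (ch_map (mf_chart i) p) al <> 0.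

(* The condition does not depend on the local section k. *)
Definition kundt_at (c : null_congruence g) (p : M) : Prop :=
  forall i, ch_dom (mf_chart i) p ->
    let x := ch_map (mf_chart i) p in
    forall U k, open U -> U x -> U `<=` ch_img (mf_chart i) ->
      local_section (nc_fibre c i) U k ->
      forall X : 'rV[R]_n,
        (forall v, nc_fibre c i x v -> inner (lm_gram g i x) X v = 0) ->
        exists t : R, nabla_vec (lm_gram g i) k x X = t *: k x.

End LorentzianManifold.
Arguments nabla_tracefree_ricci {R n M} g m.

(* Main.v *)
Require Import Defs.
From mathcomp Require Import all_boot all_order all_algebra.
From mathcomp Require Import all_classical all_reals all_analysis.
From mathcomp Require Import ring lra.

(** Everything happens in one chart, where [k] is a local section of the null
    congruence [c], [G] the Gram matrix of the metric and [S] the trace-free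
    Ricci tensor. In a null frame [k, l, m] the covector
    [beta X = g (nabla_X k) m] measures how [k] turns, and the Kundt property
    at a point says that [beta] vanishes on the plane orthogonal to [k].

    Failure of the Kundt property is an open condition
    ([not_kundt_open]), so if it fails at a point [x] it fails on an open
    neighbourhood [N] of [x]. The point of the proof is that then [S] vanishes
    on all of [N] ([not_kundt_tensor0]); as [N] meets every set that has [x]
    in its closure, [x] is not in the closure of the set where [S] is non-zero.

    That [S] vanishes on [N] is seen by removing its components one boost
    weight at a time. Since [nabla_X k = a k + beta m] and
    [nabla_X m = b k + c m - beta l], a covariant derivative raises the largest
    weight occurring in the two tensor slots of [S] by at most one, and the new
    top component is an algebraic expression in [beta X] and the old one:
    no derivatives of components survive, because the components being
    differentiated vanish identically on [N] ([nabla_vanishing]). Hence the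
    component of weight one of the j-th derivative, taken j times in one
    direction [X], is [beta X ^+ j] times a combination of the components of
    [S] of weight [1 - j]. If [X] is [k] or [m], its total boost weight is
    positive, so the alignment hypothesis makes it zero; and at a point of [N]
    one of [beta k], [beta m] is non-zero. For j = 1 this, together with the
    vanishing of the trace, kills the components of weight 0 ([stage_pos]),
    then j = 2 those of weight -1 ([stage_nonneg]), then j = 3 the one of
    weight -2 ([stage_geN1]).

    The tool for these computations is the Leibniz rule for the covariant
    derivative of a tensor field evaluated on vector fields
    ([tensor_eval_nabla]). Applied to the metric, which is parallel
    ([nabla_metric]), it gives the relation between the derivatives of [k]
    and of [m]. *)

Set Implicit Arguments.
Unset Strict Implicit.
Unset Printing Implicit Defensive.
Import Order.TTheory GRing.Theory Num.Theory.
Import numFieldNormedType.Exports.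
Local Open Scope classical_set_scope.
Local Open Scope ring_scope.

(** * Calculus of smooth functions on an open set of coordinates *)

Section Smooth.
Context {R : realType} {n : nat}.
Implicit Types (f g h : 'rV[R]_n -> R) (U : set 'rV[R]_n).

(** Differentiability is a local property; the zero germ is the case to which
    [near_differentiable] reduces, through [g = f + (g - f)]. *)
Lemma near0_differentiable {V W : normedModType R} (f : V -> W) (x : V) :
  (\forall y \near x, f y = 0) -> differentiable f x.
Proof.
move=> f0.
pose z : {linear V -> W} := \0.
have c0 : continuous z by move=> y; exact: cvg_cst.
have E : f \o shift x = cst (f x) + z +o_ 0 id.
  have f0x : \forall z \near (0 : V), f (z + x) = 0.
    move: f0; rewrite (near_shift 0 x) /=.
    by apply: filterS => y /=; rewrite subr0.
  apply/eqaddoP => _/posnumP[e]; near=> y.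
  rewrite !fctE /= (nbhs_singleton f0) add0r subr0.
  rewrite (_ : f (y + x) = 0) ?normr0 ?mulr_ge0//.
  by near: y.
have D := diff_unique c0 E.
by apply/diff_locallyP; rewrite D.
Unshelve. all: by end_near. Qed.

Lemma near_differentiable {V W : normedModType R} (f g : V -> W) (x : V) :
  (\forall y \near x, f y = g y) -> differentiable f x -> differentiable g x.
Proof.
move=> fg df; rewrite (_ : g = f + (g - f)); last by rewrite addrC subrK.
apply: differentiableD => //; apply: near0_differentiable.
by apply: filterS fg => y /=; rewrite !fctE => ->; rewrite subrr.
Qed.

Lemma foldr_partial_eq U f g (s : seq 'I_n) : open U ->
  {in U, f =1 g} -> {in U, foldr partial f s =1 foldr partial g s}.
Proof.
move=> oU fg; elim: s => //= a s IH x /set_mem Ux; rewrite /partial.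
apply: near_eq_derive; have := open_nbhs_nbhs (conj oU Ux).
by apply: filterS => y Uy; apply: IH; rewrite inE.
Qed.

(** Smoothness quantifies over all words of partial derivatives, which is
    awkward for products and quotients. It is the largest class of functions
    that are differentiable on [U] and whose partial derivatives agree on [U]
    with members of the class, so it suffices to exhibit one such class. *)
Lemma smooth_coind U (P : ('rV[R]_n -> R) -> Prop) : open U ->
  (forall f, P f -> (forall x, U x -> differentiable f x) /\
     forall a, exists2 g, P g & {in U, partial a f =1 g}) ->
  forall f, P f -> smooth_on U f.
Proof.
move=> oU Pstep f Pf s; elim/last_ind: s f Pf => [|s a IH] f Pf x Ux.
  by have [+ _] := Pstep _ Pf; exact.
have [_ /(_ a)[g Pg fg]] := Pstep _ Pf.
rewrite foldr_rcons; apply: (@near_differentiable _ _ (foldr partial g s)).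
  have := open_nbhs_nbhs (conj oU Ux); apply: filterS => y Uy.
  by symmetry; apply: (foldr_partial_eq s oU fg); rewrite inE.
exact: IH.
Qed.

Lemma smooth_differentiable {W : normedModType R} U (f : 'rV[R]_n -> W) x :
  smooth_on U f -> U x -> differentiable f x.
Proof. by move=> /(_ [::]); exact. Qed.

Lemma smooth_partial {W : normedModType R} U (f : 'rV[R]_n -> W) a :
  smooth_on U f -> smooth_on U (partial a f).
Proof. by move=> sf s x Ux; rewrite -foldr_rcons; exact: sf. Qed.

Lemma smooth_sub {W : normedModType R} U V (f : 'rV[R]_n -> W) :
  V `<=` U -> smooth_on U f -> smooth_on V f.
Proof. by move=> VU sf s x /VU; exact: sf. Qed.

(** The class that witnesses, through [smooth_coind], all closure properties of
    smooth functions at once: the Leibniz and quotient rules express partial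
    derivatives of its members by its members. *)
Inductive rational_closure U : ('rV[R]_n -> R) -> Prop :=
| rc_smooth f of smooth_on U f : rational_closure U f
| rc_cst (c : R) : rational_closure U (fun _ => c)
| rc_add f g of rational_closure U f & rational_closure U g :
    rational_closure U (fun x => f x + g x)
| rc_mul f g of rational_closure U f & rational_closure U g :
    rational_closure U (fun x => f x * g x)
| rc_inv f of rational_closure U f & (forall x, U x -> f x != 0) :
    rational_closure U (fun x => (f x)^-1).

Lemma rational_closure_smooth U f : open U -> rational_closure U f -> smooth_on U f.
Proof.
move=> oU; move: f; apply: (smooth_coind oU) => f rf; elim: rf => {f}.
- move=> f sf; split=> [x Ux|a]; first exact: smooth_differentiable sf Ux.
  by exists (partial a f) => //; apply/rc_smooth/smooth_partial.
- move=> c; split=> [x _|a]; first exact: differentiable_cst.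
  by exists (fun _ => 0); [exact: rc_cst|move=> x _; exact: derive_cst].
- move=> f g rf [df IHf] rg [dg IHg]; split=> [x Ux|a].
    exact: differentiableD (df _ Ux) (dg _ Ux).
  have [f' rf' ff'] := IHf a; have [g' rg' gg'] := IHg a.
  exists (fun x => f' x + g' x); first exact: rc_add.
  move=> x Ux; rewrite -ff'// -gg'//.
  by apply: deriveD; apply: diff_derivable; [apply: df|apply: dg]; exact/set_mem.
- move=> f g rf [df IHf] rg [dg IHg]; split=> [x Ux|a].
    exact: differentiableM (df _ Ux) (dg _ Ux).
  have [f' rf' ff'] := IHf a; have [g' rg' gg'] := IHg a.
  exists (fun x => f x * g' x + g x * f' x); first by apply: rc_add; exact: rc_mul.
  move=> x Ux; rewrite -ff'// -gg'//.
  by apply: deriveM; apply: diff_derivable; [apply: df|apply: dg]; exact/set_mem.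
- move=> f rf [df IHf] f0; split=> [x Ux|a].
    exact: differentiableV (df _ Ux) (f0 _ Ux).
  have [f' rf' ff'] := IHf a.
  exists (fun x => -1 * ((f x)^-1 * (f x)^-1) * f' x).
    by do ![apply: rc_mul]; rewrite ?f0 //; do ?[exact: rc_cst|exact: rc_inv].
  move=> x /set_mem Ux; rewrite -ff' ?inE//.
  rewrite /partial deriveV ?f0//; last exact/diff_derivable/df.
  by rewrite /GRing.scale /= mulN1r -invfM expr2.
Qed.

Lemma smooth_eq U f g : open U -> {in U, f =1 g} -> smooth_on U f -> smooth_on U g.
Proof.
move=> oU fg sf s x Ux; apply: near_differentiable (sf s x Ux).
have := open_nbhs_nbhs (conj oU Ux); apply: filterS => y Uy.
by apply: (foldr_partial_eq s oU fg); rewrite inE.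
Qed.

Lemma smooth_cst U (c : R) : open U -> smooth_on U (fun _ => c).
Proof. by move=> oU; apply: (rational_closure_smooth oU); exact: rc_cst. Qed.

Lemma smooth_add U f g : open U -> smooth_on U f -> smooth_on U g ->
  smooth_on U (fun x => f x + g x).
Proof.
by move=> oU *; apply: (rational_closure_smooth oU); apply: rc_add; exact: rc_smooth.
Qed.

Lemma smooth_mul U f g : open U -> smooth_on U f -> smooth_on U g ->
  smooth_on U (fun x => f x * g x).
Proof.
by move=> oU *; apply: (rational_closure_smooth oU); apply: rc_mul; exact: rc_smooth.
Qed.

Lemma smooth_inv U f : open U -> (forall x, U x -> f x != 0) -> smooth_on U f ->
  smooth_on U (fun x => (f x)^-1).
Proof.
by move=> oU *; apply: (rational_closure_smooth oU); apply: rc_inv => //; exact: rc_smooth.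
Qed.

Lemma smooth_opp U f : open U -> smooth_on U f -> smooth_on U (fun x => - f x).
Proof.
move=> oU sf; apply: (@smooth_eq U (fun x => -1 * f x)) => //.
  by move=> x _; rewrite mulN1r.
by apply: smooth_mul => //; exact: smooth_cst.
Qed.

Lemma smooth_sum U (I : Type) (r : seq I) (P : pred I) (F : I -> 'rV[R]_n -> R) : open U ->
  (forall i, smooth_on U (F i)) -> smooth_on U (fun x => \sum_(i <- r | P i) F i x).
Proof.
move=> oU sF; elim: r => [|i r IH].
  by under eq_fun do rewrite big_nil; exact: smooth_cst.
under eq_fun do rewrite big_cons; case: (P i) => //; exact: smooth_add.
Qed.

Lemma smooth_prod U (I : Type) (r : seq I) (F : I -> 'rV[R]_n -> R) : open U ->
  (forall i, smooth_on U (F i)) -> smooth_on U (fun x => \prod_(i <- r) F i x).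
Proof.
move=> oU sF; elim: r => [|i r IH].
  by under eq_fun do rewrite big_nil; exact: smooth_cst.
under eq_fun do rewrite big_cons; exact: smooth_mul.
Qed.

Lemma partial_entry p q (A : 'rV[R]_n -> 'M[R]_(p, q)) a i j x :
  differentiable A x -> partial a (fun y => A y i j) x = partial a A x i j.
Proof.
move=> dA; have dv : derivable A x (delta_mx 0 a) by exact: diff_derivable.
by rewrite /partial (derive_mx dv) mxE.
Qed.

Lemma differentiable_entry p q (A : 'rV[R]_n -> 'M[R]_(p, q)) i j x :
  differentiable A x -> differentiable (fun y => A y i j) x.
Proof.
move=> dA; apply: (@differentiable_comp _ _ _ _ A (fun N : 'M[R]_(p, q) => N i j)) => //.
exact: differentiable_coord.
Qed.

Lemma smooth_entry p q U (A : 'rV[R]_n -> 'M[R]_(p, q)) i j : open U ->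
  smooth_on U A -> smooth_on U (fun y => A y i j).
Proof.
move=> oU sA.
pose P (f : 'rV[R]_n -> R) :=
  exists B : 'rV[R]_n -> 'M[R]_(p, q), smooth_on U B /\ f = (fun y => B y i j).
apply: (smooth_coind oU (P := P)); last by exists A.
move=> _ [B [sB ->]]; split=> [x Ux|a].
  exact/differentiable_entry/(smooth_differentiable sB Ux).
exists (fun y => partial a B y i j); first by exists (partial a B); split=> //; exact: smooth_partial.
by move=> x /set_mem Ux; apply/partial_entry/(smooth_differentiable sB Ux).
Qed.

Lemma smooth_det p U (A : 'rV[R]_n -> 'M[R]_p) : open U ->
  (forall i j, smooth_on U (fun x => A x i j)) -> smooth_on U (fun x => \det (A x)).
Proof.
move=> oU sA; rewrite /determinant; apply: smooth_sum => // s.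
by apply: smooth_mul => //; [exact: smooth_cst|exact: smooth_prod].
Qed.

(** Cramer's rule makes the inverse a rational function of the entries. *)
Lemma smooth_invmx p U (A : 'rV[R]_n -> 'M[R]_p) i j : open U ->
  (forall x, U x -> A x \in unitmx) ->
  (forall i j, smooth_on U (fun x => A x i j)) -> smooth_on U (fun x => invmx (A x) i j).
Proof.
move=> oU uA sA.
apply: (@smooth_eq U (fun x => (\det (A x))^-1 * ((-1) ^+ (j + i) * \det (row' j (col' i (A x)))))) => //.
  by move=> x /set_mem Ux; rewrite /invmx uA// !mxE.
apply: smooth_mul => //.
  apply: smooth_inv => // [x Ux|]; last exact: smooth_det.
  by have := uA _ Ux; rewrite unitmxE unitfE.
apply: smooth_mul => //; first exact: smooth_cst.
apply: smooth_det => // i' j'; apply: (@smooth_eq U (fun x => A x (lift j i') (lift i j'))) => //.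
by move=> x _; rewrite !mxE.
Qed.

Lemma derive_partial {W : normedModType R} (f : 'rV[R]_n -> W) x (v : 'rV[R]_n) :
  differentiable f x -> 'D_v f x = \sum_a v 0 a *: partial a f x.
Proof.
move=> df; rewrite deriveE// {1}[v]row_sum_delta linear_sum /=.
by apply: eq_bigr => a _; rewrite linearZ /= /partial deriveE.
Qed.

End Smooth.

(** * Tensor evaluation and the Leibniz rule *)

Section TensorEvaluation.
Context {R : realType} {n : nat}.
Implicit Types (G : 'rV[R]_n -> 'M[R]_n) (x X v w : 'rV[R]_n) (s : seq 'rV[R]_n).

(** Fixing the first index is what makes induction on the rank possible. *)
Definition slice r (T : @tensor R n r.+1) (a : 'I_n) : @tensor R n r :=
  fun al => T [tuple of a :: al].

(** The arguments form a plain sequence rather than a tuple, so that slots can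
    be addressed by concatenation and no cast on the rank is ever needed; the
    value is meaningful for sequences of length [r]. *)
Fixpoint tensor_eval r : @tensor R n r -> seq 'rV[R]_n -> R :=
  match r with
  | 0 => fun T _ => T [tuple]
  | r'.+1 => fun T s => \sum_a head 0 s 0 a * tensor_eval (slice T a) (behead s)
  end.

Lemma tensor_eval_cons r (T : tensor r.+1) v s :
  tensor_eval T (v :: s) = \sum_a v 0 a * tensor_eval (slice T a) s.
Proof. by []. Qed.

Lemma tensor_eval_sum r (I : Type) (q : seq I) (c : I -> R) (T : I -> tensor r) s :
  tensor_eval (fun al => \sum_(i <- q) c i * T i al) s = \sum_(i <- q) c i * tensor_eval (T i) s.
Proof.
elim: r T s => [|r IH] T s //=.
under eq_bigr do rewrite /slice IH mulr_sumr.
rewrite exchange_big /=; apply: eq_bigr => i _; rewrite mulr_sumr.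
by apply: eq_bigr => a _; rewrite mulrCA.
Qed.

Lemma eq_tensor_eval r (T T' : tensor r) s : T =1 T' -> tensor_eval T s = tensor_eval T' s.
Proof. by move=> TT'; congr tensor_eval; apply/funext. Qed.

Lemma tensor_evalB r (T T' : tensor r) s :
  tensor_eval (fun al => T al - T' al) s = tensor_eval T s - tensor_eval T' s.
Proof.
elim: r T T' s => [|r IH] T T' s //=; rewrite -sumrB.
by apply: eq_bigr => a _; rewrite -mulrBr -IH.
Qed.

Lemma tensor_eval_lin r (T : tensor r) s1 s2 a u v : (size s1 < r)%N ->
  tensor_eval T (s1 ++ (a *: u + v) :: s2) =
  a * tensor_eval T (s1 ++ u :: s2) + tensor_eval T (s1 ++ v :: s2).
Proof.
elim: s1 r T => [|w s1 IH] [|r] T //= lt_r.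
  rewrite mulr_sumr -big_split /=; apply: eq_bigr => i _.
  by rewrite !mxE mulrDl mulrA.
rewrite mulr_sumr -big_split /=; apply: eq_bigr => i _.
by rewrite IH// mulrDr mulrCA.
Qed.

Lemma big_tuple_cons r (F : r.+1.-tuple 'I_n -> R) :
  \sum_al F al = \sum_a \sum_(al : r.-tuple 'I_n) F [tuple of a :: al].
Proof.
rewrite pair_big /=.
rewrite (reindex (fun p : 'I_n * r.-tuple 'I_n => [tuple of p.1 :: p.2])) //=.
exists (fun al => (thead al, [tuple of behead al])) => [[a al] _|al _] /=.
  by congr (_, _); apply: val_inj.
by rewrite -tuple_eta.
Qed.

Lemma frame_component_eval r (T : tensor r) (e : 'M[R]_n) (al : r.-tuple 'I_n) :
  frame_component T e al = tensor_eval T [seq row i e | i <- al].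
Proof.
elim: r T al => [|r IH] T al.
  rewrite /frame_component (big_pred1 [tuple]) => [|be]; last by apply/esym/eqP; exact: tuple0.
  by rewrite big_ord0 mulr1.
case/tupleP: al => a al.
rewrite /frame_component big_tuple_cons tensor_eval_cons.
apply: eq_bigr => b _; rewrite -IH /frame_component mulr_sumr mxE.
apply: eq_bigr => be _; rewrite big_ord_recl !tnth0 mulrCA; congr (_ * (_ * _)).
by apply: eq_bigr => j _; rewrite !tnthS.
Qed.

(** Slicing and covariant differentiation commute up to the Christoffel term
    of the fixed slot. *)
Lemma nabla_slice G r (T : tensor_field r.+1) x a b (al : r.-tuple 'I_n) :
  nabla G T x [tuple of a :: [tuple of b :: al]] =
  nabla G (fun y => slice (T y) b) x [tuple of a :: al]
  - \sum_c christoffel G x c a b * T x [tuple of c :: al].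
Proof.
rewrite /nabla !theadE.
have -> : [tuple of behead [tuple of a :: [tuple of b :: al]]] = [tuple of b :: al] by exact: val_inj.
have -> : [tuple of behead [tuple of a :: al]] = al by exact: val_inj.
rewrite big_ord_recl tnth0 -addrA -opprD; congr (_ - _); rewrite addrC; congr (_ + _).
  apply: eq_bigr => j _; apply: eq_bigr => c _; rewrite tnthS /slice; congr (_ * T x _).
  apply: eq_from_tnth => i; rewrite tnth_mktuple.
  case: (unliftP ord0 i) => [i'|] ->; rewrite ?tnthS ?tnth0 // tnth_mktuple.
  by rewrite (inj_eq (@lift_inj _ _)).
apply: eq_bigr => c _; congr (_ * T x _).
apply: eq_from_tnth => i; rewrite tnth_mktuple.
by case: (unliftP ord0 i) => [i'|] ->; rewrite ?tnthS ?tnth0.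
Qed.

Lemma nabla_vecE G (k : 'rV[R]_n -> 'rV[R]_n) x X b : differentiable k x ->
  nabla_vec G k x X 0 b = 'D_X (fun y => k y 0 b) x
    + \sum_a \sum_c christoffel G x b a c * X 0 a * k x 0 c.
Proof.
move=> dk; have dv : derivable k x X by exact: diff_derivable.
by rewrite /nabla_vec !mxE (derive_mx dv) mxE.
Qed.

Definition differentiable_tensor r (T : @tensor_field R n r) x :=
  forall al, differentiable (fun y => T y al) x.

Definition at_point (s : seq ('rV[R]_n -> 'rV[R]_n)) x : seq 'rV[R]_n := [seq A x | A <- s].

Lemma differentiable_bigsum (V W : normedModType R) (I : Type) (q : seq I)
    (F : I -> V -> W) (x : V) :
  (forall i, differentiable (F i) x) -> differentiable (fun y => \sum_(i <- q) F i y) x.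
Proof.
move=> dF; elim: q => [|i q IH].
  by under eq_fun do rewrite big_nil; exact: differentiable_cst.
by under eq_fun do rewrite big_cons; exact: differentiableD.
Qed.

Lemma derive_bigsum (V W : normedModType R) (I : Type) (q : seq I)
    (F : I -> V -> W) (x v : V) :
  (forall i, differentiable (F i) x) ->
  'D_v (fun y => \sum_(i <- q) F i y) x = \sum_(i <- q) 'D_v (F i) x.
Proof.
move=> dF; elim: q => [|i q IH].
  by under eq_fun do rewrite big_nil; rewrite big_nil; exact: derive_cst.
rewrite big_cons -IH; under eq_fun do rewrite big_cons.
by apply: deriveD; apply: diff_derivable => //; exact: differentiable_bigsum.
Qed.

Lemma differentiable_tensor_eval r (T : tensor_field r)
    (s : seq ('rV[R]_n -> 'rV[R]_n)) x :
  differentiable_tensor T x -> (forall j, differentiable (nth (fun=> 0) s j) x) ->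
  differentiable (fun y => tensor_eval (T y) (at_point s y)) x.
Proof.
elim: r T s => [|r IH] T s dT ds; first exact: dT.
apply: differentiable_bigsum => a; apply: differentiableM.
  rewrite (_ : (fun _ => _) = fun y => nth (fun=> 0) s 0 y 0 a).
    by apply: differentiable_entry; exact: ds.
  by apply/funext => y; case: (s).
rewrite (_ : (fun _ => _) = fun y => tensor_eval (slice (T y) a) (at_point (behead s) y)); last first.
  by apply/funext => y; case: (s).
by apply: IH => [al|j]; [exact: dT | rewrite nth_behead].
Qed.

(** The Leibniz rule [X (T (s_1, .., s_r)) = (nabla_X T) (s_1, .., s_r) +
    sum_j T (s_1, .., nabla_X s_j, .., s_r)] for vector fields [s_j]. By
    induction on the rank: the Christoffel term left over by [nabla_slice] is
    the connection part of [nabla_X s_1]. *)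
Theorem tensor_eval_nabla G r (T : tensor_field r)
    (s : seq ('rV[R]_n -> 'rV[R]_n)) x X : size s = r ->
  differentiable_tensor T x -> (forall j, differentiable (nth (fun=> 0) s j) x) ->
  tensor_eval (nabla G T x) (X :: at_point s x) =
  'D_X (fun y => tensor_eval (T y) (at_point s y)) x
  - \sum_(j < r) tensor_eval (T x)
      (set_nth 0 (at_point s x) j (nabla_vec G (nth (fun=> 0) s j) x X)).
Proof.
elim: r T s => [|r IH] T s sr dT ds.
  case: s sr ds => // _ _.
  rewrite big_ord0 subr0 /= (derive_partial _ (dT [tuple])).
  apply: eq_bigr => a _; rewrite /slice /nabla big_ord0 subr0 theadE.
  congr (_ * _); congr (partial a _ x); apply/funext => y; congr (T y _).
  exact: val_inj.
case: s sr ds => // A s [sr] ds.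
have dA : differentiable A x := ds 0%N.
have ds' j : differentiable (nth (fun=> 0) s j) x := ds j.+1.
have dTs b : differentiable_tensor (fun y => slice (T y) b) x by move=> al; exact: dT.
rewrite big_ord_recl /=.
under eq_bigr => a _.
  rewrite [X in _ * X](_ : _ = \sum_b A x 0 b *
     (tensor_eval (slice (nabla G (fun y => slice (T y) b) x) a) (at_point s x)
     - \sum_c christoffel G x c a b * tensor_eval (slice (T x) c) (at_point s x))); last first.
    apply: eq_bigr => b _; rewrite -tensor_eval_sum -tensor_evalB; congr (_ * _).
    apply: eq_tensor_eval => al; exact: nabla_slice.
  under eq_bigr do rewrite mulrBr.
  rewrite sumrB mulrBr.
  over.
rewrite sumrB.
have -> : \sum_a X 0 a * \sum_b A x 0 b *
     tensor_eval (slice (nabla G (fun y => slice (T y) b) x) a) (at_point s x)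
   = \sum_b A x 0 b * tensor_eval (nabla G (fun y => slice (T y) b) x) (X :: at_point s x).
  under eq_bigr do rewrite mulr_sumr.
  rewrite exchange_big; apply: eq_bigr => b _; rewrite tensor_eval_cons mulr_sumr.
  by apply: eq_bigr => a _; rewrite mulrCA.
pose C b y := tensor_eval (slice (T y) b) (at_point s y).
(* The connection part of component [c] of [nabla_X A]. *)
pose G' c := \sum_a \sum_b christoffel G x c a b * X 0 a * A x 0 b.
have E1 : \sum_a X 0 a * \sum_b A x 0 b * \sum_c christoffel G x c a b * C c x =
    \sum_c G' c * C c x.
  under [RHS]eq_bigr => c _ do rewrite mulr_suml.
  rewrite exchange_big; apply: eq_bigr => a _.
  under [RHS]eq_bigr => c _ do rewrite mulr_suml.
  rewrite exchange_big mulr_sumr; apply: eq_bigr => b _.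
  by rewrite !mulr_sumr; apply: eq_bigr => c _; ring.
have E2 : \sum_a nabla_vec G A x X 0 a * C a x =
    \sum_a 'D_X (fun y => A y 0 a) x * C a x + \sum_c G' c * C c x.
  by rewrite -big_split; apply: eq_bigr => b _; rewrite nabla_vecE// mulrDl.
have E3 : 'D_X (fun y => \sum_a A y 0 a * C a y) x =
    \sum_a A x 0 a * 'D_X (C a) x + \sum_a 'D_X (fun y => A y 0 a) x * C a x.
  have dC a : differentiable (C a) x by exact: differentiable_tensor_eval.
  have dAa a : differentiable (fun y => A y 0 a) x by exact: differentiable_entry.
  rewrite derive_bigsum -?big_split /= => [|a]; last exact: differentiableM.
  apply: eq_bigr => a _; rewrite deriveM; try exact: diff_derivable.
  by congr (_ + _); exact: mulrC.
rewrite [X in _ = X - _]E3 E2 E1.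
under [X in X - _ = _]eq_bigr => b _ do
  rewrite (IH (fun y => slice (T y) b) s sr (dTs b) ds') mulrBr mulr_sumr.
rewrite sumrB [X in _ - X - _]exchange_big /=.
ring.
Qed.
End TensorEvaluation.

(** * Covariant derivatives of vanishing components; the metric is parallel *)

Section Vanishing.
Context {R : realType} {n : nat}.
Implicit Types (G : 'rV[R]_n -> 'M[R]_n) (x X v w : 'rV[R]_n).

Lemma set_nth_cat (T : Type) (x0 : T) (s t : seq T) i y :
  set_nth x0 (s ++ t) i y =
  if (i < size s)%N then set_nth x0 s i y ++ t else s ++ set_nth x0 t (i - size s) y.
Proof.
elim: s i => [|a s IH] [|i] //=.
by rewrite IH ltnS subSS; case: ifP.
Qed.

(** If the components [T (.., A, B)] vanish identically near a point, the
    Leibniz rule contains no derivative: both the derivative of [T (Ys, A, B)]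
    and the terms in which [X] differentiates one of [Ys] are zero. *)
Lemma nabla_vanishing G m (T : tensor_field m.+2) (A B : 'rV[R]_n -> 'rV[R]_n) x :
  differentiable_tensor T x -> differentiable A x -> differentiable B x ->
  (forall Ys, size Ys = m -> \forall y \near x, tensor_eval (T y) (Ys ++ [:: A y; B y]) = 0) ->
  forall X Ys, size Ys = m ->
  tensor_eval (nabla G T x) (X :: Ys ++ [:: A x; B x]) =
  - tensor_eval (T x) (Ys ++ [:: nabla_vec G A x X; B x])
  - tensor_eval (T x) (Ys ++ [:: A x; nabla_vec G B x X]).
Proof.
move=> dT dA dB T0 X Ys sY.
(* Only the values of [Ys] at [x] matter; constant fields extend them. *)
pose s := [seq (fun=> Y) | Y <- Ys] ++ [:: A; B].
have sE y : at_point s y = Ys ++ [:: A y; B y].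
  by rewrite /at_point map_cat -map_comp map_id.
rewrite -sE tensor_eval_nabla //; first last.
- move=> j; rewrite nth_cat; case: ltnP => [|_].
    by rewrite size_map => jY; rewrite (nth_map 0)//; exact: differentiable_cst.
  by case: (j - _)%N => [|[|i]] //=; rewrite nth_nil; exact: differentiable_cst.
- by rewrite size_cat size_map sY addn2.
rewrite (_ : 'D_X _ x = 0); last first.
  rewrite -(derive_cst (0 : R) x X); apply: near_eq_derive.
  by apply: filterS (T0 _ sY) => y; rewrite sE.
rewrite sE !big_ord_recr /= big1 => [|j _]; last first.
  rewrite set_nth_cat sY ltn_ord; apply: (nbhs_singleton (T0 _ _)).
  by rewrite size_set_nth sY; apply/maxn_idPr.
rewrite !set_nth_cat sY ltnn subnn ltnNge leqnSn /= subSnn /=.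
rewrite !nth_cat size_map sY ltnn subnn ltnNge leqnSn /= subSnn /=.
by rewrite !add0r opprD.
Qed.

Definition metric_tensor G : @tensor_field R n 2 :=
  fun x al => G x (tnth al ord0) (tnth al ord_max).

Lemma tensor_eval2 (T : @tensor R n 2) v w :
  tensor_eval T [:: v; w] = \sum_a \sum_b v 0 a * w 0 b * T [tuple a; b].
Proof.
rewrite /=; apply: eq_bigr => a _; rewrite mulr_sumr; apply: eq_bigr => b _.
by rewrite /slice mulrA; congr (_ * _ * T _); exact: val_inj.
Qed.

Lemma tensor_eval_metric G x v w : tensor_eval (metric_tensor G x) [:: v; w] = inner (G x) v w.
Proof.
rewrite tensor_eval2 /inner mxE exchange_big; apply: eq_bigr => b _.
rewrite !mxE mulr_suml; apply: eq_bigr => a _.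
by rewrite /metric_tensor /= mulrAC.
Qed.

Lemma lower_christoffel G x a b d : (G x)^T = G x -> G x \in unitmx ->
  \sum_c christoffel G x c a b * G x c d =
  2^-1 * (partial a (fun y => G y b d) x + partial b (fun y => G y a d) x
     - partial d (fun y => G y a b) x).
Proof.
move=> symG uG.
under eq_bigr => c _ do rewrite /christoffel -mulrA mulr_suml.
rewrite -mulr_sumr; congr (_ * _); rewrite exchange_big /=.
have GG e : \sum_c invmx (G x) c e * G x c d = (e == d)%:R.
  have /matrixP/(_ e d) := mulVmx uG; rewrite !mxE => <-.
  apply: eq_bigr => c _; congr (_ * _).
  by rewrite -[in LHS]symG -trmx_inv mxE.
rewrite (bigD1 d) //= [X in _ + X]big1 => [|e ed]; last first.
  under eq_bigr do rewrite mulrAC.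
  by rewrite -mulr_suml GG (negbTE ed) mul0r.
under eq_bigr do rewrite mulrAC.
by rewrite -mulr_suml GG eqxx mul1r addr0.
Qed.

(** The metric is parallel: lowering the index of the Christoffel symbols turns
    the two connection terms into the two halves of [partial_a G_bd]. *)
Lemma nabla_metric G x al : (\forall y \near x, (G y)^T = G y) -> G x \in unitmx ->
  nabla G (metric_tensor G) x al = 0.
Proof.
move=> symG uG; have sG := nbhs_singleton symG.
have pG a b d : partial a (fun y => G y b d) x = partial a (fun y => G y d b) x.
  by apply: near_eq_derive; apply: filterS symG => y yG; rewrite -[in LHS]yG mxE.
case/tupleP: al => a al; case/tupleP: al => b al; case/tupleP: al => d al.
rewrite /nabla theadE /metric_tensor.
set be := [tuple of behead _].
have b0 : tnth be ord0 = b by [].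
have b1 : tnth be ord_max = d by [].
rewrite b0 b1 2!big_ord_recl big_ord0 addr0.
have S i j : G x i j = G x j i by rewrite -[in LHS]sG mxE.
rewrite (_ : lift ord0 ord0 = ord_max); last exact: val_inj.
rewrite b0 b1.
transitivity (partial a (fun y => G y b d) x -
   (\sum_c christoffel G x c a b * G x c d + \sum_c christoffel G x c a d * G x c b)).
  congr (_ - (_ + _)); apply: eq_bigr => c _; rewrite /set_index !tnth_mktuple /=.
    by rewrite b1.
  by rewrite b0 S.
rewrite !lower_christoffel// (pG d a b) (pG b a d) (pG a d b).
by lra.
Qed.

(** Metric compatibility for fields that stay orthogonal, an instance of
    [nabla_vanishing] since the metric is parallel. *)
Lemma nabla_orthogonal G (A B : 'rV[R]_n -> 'rV[R]_n) x X :
  (\forall y \near x, (G y)^T = G y) -> G x \in unitmx ->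
  differentiable G x -> differentiable A x -> differentiable B x ->
  (\forall y \near x, inner (G y) (A y) (B y) = 0) ->
  inner (G x) (nabla_vec G A x X) (B x) = - inner (G x) (A x) (nabla_vec G B x X).
Proof.
move=> symG uG dG dA dB AB0.
have dT : differentiable_tensor (metric_tensor G) x.
  by move=> al; exact: differentiable_entry.
have nG0 v w : tensor_eval (nabla G (metric_tensor G) x) [:: X; v; w] = 0.
  rewrite tensor_eval_cons big1 // => a _; rewrite tensor_eval2 big1 ?mulr0// => b _.
  by rewrite big1 // => c _; rewrite /slice nabla_metric// mulr0.
have AB0' Ys : size Ys = 0%N ->
    \forall y \near x, tensor_eval (metric_tensor G y) (Ys ++ [:: A y; B y]) = 0.
  by case: Ys => // _; apply: filterS AB0 => y; rewrite tensor_eval_metric.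
have : tensor_eval (nabla G (metric_tensor G) x) [:: X; A x; B x] =
    - tensor_eval (metric_tensor G x) [:: nabla_vec G A x X; B x]
    - tensor_eval (metric_tensor G x) [:: A x; nabla_vec G B x X].
  exact: (@nabla_vanishing G 0 (metric_tensor G) A B x dT dA dB AB0' X [::] erefl).
rewrite nG0 !tensor_eval_metric => /esym/eqP.
by rewrite subr_eq0 eqr_oppLR => /eqP.
Qed.
End Vanishing.

(** * Pairings, and tensors as bilinear forms in their last two slots *)

Section Inner.
Context {R : realType} {n : nat}.
Implicit Types (A : 'M[R]_n) (u v w : 'rV[R]_n).

Lemma innerDl A u v w : inner A (u + v) w = inner A u w + inner A v w.
Proof. by rewrite /inner !mulmxDl mxE. Qed.

Lemma innerZl A a u w : inner A (a *: u) w = a * inner A u w.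
Proof. by rewrite /inner -!scalemxAl mxE. Qed.

Lemma innerDr A u v w : inner A w (u + v) = inner A w u + inner A w v.
Proof. by rewrite /inner linearD mulmxDr mxE. Qed.

Lemma innerZr A a u w : inner A w (a *: u) = a * inner A w u.
Proof. by rewrite /inner linearZ -scalemxAr mxE. Qed.

Lemma innerC A u w : A^T = A -> inner A u w = inner A w u.
Proof.
move=> sA; rewrite /inner -[in RHS](trmxK (w *m A *m u^T)) [RHS]mxE.
by rewrite !trmx_mul trmxK sA mulmxA.
Qed.

Lemma differentiable_inner (G : 'rV[R]_n -> 'M[R]_n) (B C : 'rV[R]_n -> 'rV[R]_n) x :
  differentiable G x -> (forall i, differentiable (fun y => B y 0 i) x) -> differentiable C x ->
  differentiable (fun y => inner (G y) (B y) (C y)) x.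
Proof.
move=> dG dB dC; under eq_fun do rewrite /inner mxE; apply: differentiable_bigsum => j.
apply: differentiableM.
  under eq_fun do rewrite mxE; apply: differentiable_bigsum => i.
  by apply: differentiableM => //; exact: differentiable_entry.
by under eq_fun do rewrite mxE; exact: differentiable_entry.
Qed.

End Inner.

Section Last2.
Context {R : realType} {n m : nat}.
Implicit Types (T : @tensor R n m.+2) (u v w : 'rV[R]_n) (s : seq 'rV[R]_n).

(** Iterated covariant derivatives put the differentiation slots first, so the
    two slots of the original tensor are always the last ones. *)
Definition last2 T s u v : R := tensor_eval T (s ++ [:: u; v]).

Lemma last2Dl T s u v w : size s = m -> last2 T s (u + v) w = last2 T s u w + last2 T s v w.
Proof.
by move=> sm; rewrite -[u in LHS]scale1r /last2 tensor_eval_lin ?mul1r// sm.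
Qed.

Lemma last2Zl T s a u w : size s = m -> last2 T s (a *: u) w = a * last2 T s u w.
Proof.
move=> sm; have l0 : last2 T s 0 w = 0.
  have := last2Dl T 0 0 w sm; rewrite addr0 => /eqP.
  by rewrite -subr_eq0 opprD addNKr oppr_eq0 => /eqP.
by rewrite -[_ *: u]addr0 /last2 tensor_eval_lin ?sm// -!/(last2 _ _ _ _) l0 addr0.
Qed.

Lemma last2Dr T s u v w : size s = m -> last2 T s w (u + v) = last2 T s w u + last2 T s w v.
Proof.
move=> sm; rewrite -[u in LHS]scale1r /last2 -!(cat_rcons w).
by rewrite tensor_eval_lin ?mul1r// size_rcons sm.
Qed.

Lemma last2Zr T s a u w : size s = m -> last2 T s w (a *: u) = a * last2 T s w u.
Proof.
move=> sm; have l0 : last2 T s w 0 = 0.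
  have := last2Dr T 0 0 w sm; rewrite addr0 => /eqP.
  by rewrite -subr_eq0 opprD addNKr oppr_eq0 => /eqP.
rewrite -[_ *: u]addr0 /last2 -!(cat_rcons w) tensor_eval_lin ?size_rcons ?sm//.
by rewrite !cat_rcons -!/(last2 _ _ _ _) l0 addr0.
Qed.

End Last2.

Section Filtration.
Context {R : realType} (G : 'rV[R]_3 -> 'M[R]_3) (N : set 'rV[R]_3)
  (k : 'rV[R]_3 -> 'rV[R]_3).
Context (oN : open N) (symG : forall y, N y -> (G y)^T = G y)
  (unitG : forall y, N y -> G y \in unitmx)
  (dG : forall y, N y -> differentiable G y)
  (dk : forall y, N y -> differentiable k y)
  (knull : forall y, N y -> inner (G y) (k y) (k y) = 0)
  (kn0 : forall y, N y -> exists l, inner (G y) (k y) l != 0).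
Implicit Types (x y X Y u v w l : 'rV[R]_3) (s : seq 'rV[R]_3).

Definition perp y v := inner (G y) (k y) v = 0.

(** In the last two slots [k], [m], [l] count as weights 1, 0, -1. The next
    three predicates say that on [N] all components of weight at least 1, at
    least 0, at least -1 vanish, respectively, whatever vectors fill the
    differentiation slots. The component [(k, l)] has weight 0 like [(m, m)],
    whence the two clauses of [vanish_nonneg]. *)
Definition vanish_pos m (B : @tensor_field R 3 m.+2) := forall y s u, N y -> size s = m ->
  perp y u -> last2 (B y) s (k y) u = 0 /\ last2 (B y) s u (k y) = 0.

Definition vanish_nonneg m (B : @tensor_field R 3 m.+2) :=
  (forall y s v, N y -> size s = m ->
     last2 (B y) s (k y) v = 0 /\ last2 (B y) s v (k y) = 0) /\
  (forall y s u v, N y -> size s = m -> perp y u -> perp y v -> last2 (B y) s u v = 0).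

Definition vanish_geN1 m (B : @tensor_field R 3 m.+2) := forall y s u v, N y -> size s = m ->
  perp y u -> last2 (B y) s u v = 0 /\ last2 (B y) s v u = 0.

Definition differentiable_on m (B : @tensor_field R 3 m) := forall y, N y -> differentiable_tensor B y.

Lemma near_N y (P : 'rV[R]_3 -> Prop) : N y -> (forall z, N z -> P z) -> \forall z \near y, P z.
Proof. by move=> Ny NP; have := open_nbhs_nbhs (conj oN Ny); apply: filterS. Qed.

Lemma perp_k y : N y -> perp y (k y).
Proof. exact: knull. Qed.

(** A null field has constant norm. *)
Lemma perp_nabla_k y X : N y -> perp y (nabla_vec G k y X).
Proof.
move=> Ny; have := @nabla_orthogonal _ _ G k k y X.
rewrite (innerC _ _ (symG Ny)) -/(perp _ _) => /(_ _ _ _ _ _ _)/eqP.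
rewrite -addr_eq0 -mulr2n mulrn_eq0 /= => H; apply/eqP/H; rewrite ?unitG; auto.
  exact: near_N.
exact: near_N.
Qed.

(** Projecting the constant field [u] to the plane orthogonal to [k] along a
    fixed direction [l] not orthogonal to [k] keeps it differentiable and
    orthogonal to [k] on all of [N]; the factors are arranged so that no
    division by a function is needed. *)
Lemma perp_extension y u : N y -> perp y u ->
  exists W : 'rV[R]_3 -> 'rV[R]_3, [/\ W y = u,
    (forall z, N z -> differentiable W z) & forall z, N z -> perp z (W z)].
Proof.
move=> Ny pu; have [l kl] := kn0 Ny.
pose c := (inner (G y) (k y) l)^-1.
exists (fun z => (c * inner (G z) (k z) l) *: u - (c * inner (G z) (k z) u) *: l).
split=> [|z Nz|z Nz].
- by rewrite [inner _ _ u]pu mulr0 scale0r subr0 mulVf// scale1r.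
- apply: differentiableB; apply: differentiableZl; apply: differentiableM;
    try exact: differentiable_cst; apply: differentiable_inner;
    do ?[exact: dG | exact: differentiable_cst
        | by move=> i; apply: differentiable_entry; exact: dk].
- by rewrite /perp innerDr -scaleNr !innerZr; ring.
Qed.

Lemma last2_nabla m (B : tensor_field m.+2) (V W : 'rV[R]_3 -> 'rV[R]_3) y X s :
  differentiable_on B -> N y -> size s = m -> differentiable V y -> differentiable W y ->
  (forall z s', N z -> size s' = m -> last2 (B z) s' (V z) (W z) = 0) ->
  last2 (nabla G B y : tensor m.+3) (X :: s) (V y) (W y) =
  - last2 (B y) s (nabla_vec G V y X) (W y) - last2 (B y) s (V y) (nabla_vec G W y X).
Proof.
move=> dB Ny sm dV dW B0; apply: nabla_vanishing => //; first exact: dB.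
by move=> s' s'm; apply: near_N => // z Nz; exact: B0.
Qed.

(** Since [nabla_X k] is orthogonal to [k], covariant differentiation raises
    weights by at most one; [vanish_nonneg_nabla] has the same reason. *)
Lemma vanish_pos_nabla m (B : tensor_field m.+2) : differentiable_on B ->
  vanish_nonneg B -> vanish_pos (nabla G B : tensor_field m.+3).
Proof.
move=> dB [Bk Bp] y [//|X s] u Ny [sm] pu.
have [W [Wy dW pW]] := perp_extension Ny pu; rewrite -Wy.
have [pnk pWy] := (perp_nabla_k X Ny, pW y Ny).
split; rewrite last2_nabla //; first [exact: dk | exact: dW | idtac].
- by rewrite (Bp _ _ _ _ Ny sm pnk pWy) (Bk _ _ _ Ny sm).1 oppr0 addr0.
- by move=> z s' Nz s'm; exact: (Bk _ _ _ Nz s'm).1.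
- by rewrite (Bp _ _ _ _ Ny sm pWy pnk) (Bk _ _ _ Ny sm).2 oppr0 addr0.
- by move=> z s' Nz s'm; exact: (Bk _ _ _ Nz s'm).2.
Qed.

Lemma vanish_nonneg_nabla m (B : tensor_field m.+2) : differentiable_on B ->
  vanish_geN1 B -> vanish_nonneg (nabla G B : tensor_field m.+3).
Proof.
move=> dB Bp; split=> y [//|X s].
  move=> v Ny [sm]; have pnk := perp_nabla_k X Ny.
  have dv : differentiable (cst v : 'rV[R]_3 -> 'rV[R]_3) y by exact: differentiable_cst.
  have pk := perp_k.
  split; rewrite -[v]/(cst v y) last2_nabla //; first [exact: dk | idtac].
  - by rewrite (Bp _ _ _ _ Ny sm pnk).1 (Bp _ _ _ _ Ny sm (pk _ Ny)).1 oppr0 addr0.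
  - by move=> z s' Nz s'm; exact: (Bp _ _ _ _ Nz s'm (pk _ Nz)).1.
  - by rewrite (Bp _ _ _ _ Ny sm pnk).2 (Bp _ _ _ _ Ny sm (pk _ Ny)).2 oppr0 addr0.
  - by move=> z s' Nz s'm; exact: (Bp _ _ _ _ Nz s'm (pk _ Nz)).2.
move=> u v Ny [sm] pu pv.
have [U [Uy dU pU]] := perp_extension Ny pu.
have [V [Vy dV pV]] := perp_extension Ny pv.
rewrite -Uy -Vy last2_nabla //; first [exact: dU | exact: dV | idtac].
- by rewrite (Bp _ _ _ _ Ny sm (pV y Ny)).2 (Bp _ _ _ _ Ny sm (pU y Ny)).1 oppr0 addr0.
- by move=> z s' Nz s'm; exact: (Bp _ _ _ _ Nz s'm (pU z Nz)).1.
Qed.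

(* e frame *)
(** The first-order data at [y] of a frame [k, l, m]: [W] extends [m]
    orthogonally to [k], and [beta] measures how [k] turns into [m] along [X].
    The coefficient [- beta] of [l] is forced by orthogonality; the components
    along [k] and the component [c] along [m], which is present because [W] is
    not normalized away from [y], leave leading terms unchanged. *)
Definition rotation y l m X (W : 'rV[R]_3 -> 'rV[R]_3) (beta : R) :=
  [/\ W y = m, (forall z, N z -> differentiable W z), (forall z, N z -> perp z (W z)),
   (exists a, nabla_vec G k y X = a *: k y + beta *: m) &
   (exists b c, nabla_vec G W y X = b *: k y + c *: m + (- beta) *: l)].

Context (y l m X : 'rV[R]_3) (W : 'rV[R]_3 -> 'rV[R]_3) (beta : R).
Context (Ny : N y) (rot : rotation y l m X W beta).

Let pm : perp y m. Proof. by case: rot => <- _ + _ _; exact. Qed.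

(** The three lemmas [lead_pos], [lead_nonneg] and [lead_geN1] compute the
    components of top weight of the derivative along [X]: they are [beta] times
    combinations of the components of top weight of [B]. *)
Lemma lead_pos j (B : tensor_field j.+2) s : size s = j -> differentiable_on B ->
  vanish_pos B ->
  last2 (nabla G B y : tensor j.+3) (X :: s) (k y) m =
    beta * (last2 (B y) s (k y) l - last2 (B y) s m m) /\
  last2 (nabla G B y : tensor j.+3) (X :: s) m (k y) =
    beta * (last2 (B y) s l (k y) - last2 (B y) s m m).
Proof.
move=> sj dB Bp; have [Wy dW pW [a nk] [b [c nW]]] := rot.
have kk := Bp _ _ _ Ny sj (perp_k Ny); have km := Bp _ _ _ Ny sj pm.
split; rewrite -{1}Wy last2_nabla //; first [exact: dk | exact: dW | idtac].
- rewrite nk nW Wy !(last2Dl, last2Dr, last2Zl, last2Zr)// km.1 kk.1; ring.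
- by move=> z s' Nz s'm; exact: (Bp _ _ _ Nz s'm (pW z Nz)).1.
- rewrite nk nW Wy !(last2Dl, last2Dr, last2Zl, last2Zr)// km.2 kk.1; ring.
- by move=> z s' Nz s'm; exact: (Bp _ _ _ Nz s'm (pW z Nz)).2.
Qed.

Lemma lead_nonneg j (B : tensor_field j.+2) s : size s = j -> differentiable_on B ->
  vanish_nonneg B ->
  [/\ last2 (nabla G B y : tensor j.+3) (X :: s) (k y) l =
     - (beta * last2 (B y) s m l),
   last2 (nabla G B y : tensor j.+3) (X :: s) l (k y) =
     - (beta * last2 (B y) s l m) &
   last2 (nabla G B y : tensor j.+3) (X :: s) m m =
     beta * (last2 (B y) s l m + last2 (B y) s m l)].
Proof.
move=> sj dB [Bk Bp]; have [Wy dW pW [a nk] [b [c nW]]] := rot.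
have kv v := (Bk _ _ v Ny sj).1; have vk v := (Bk _ _ v Ny sj).2.
have mm := Bp _ _ _ _ Ny sj pm pm.
have dl : differentiable (cst l : 'rV[R]_3 -> 'rV[R]_3) y by exact: differentiable_cst.
split.
- rewrite -[l in LHS]/(cst l y) last2_nabla //; [|exact: dk|by move=> z s' Nz s'm; exact: (Bk _ _ _ Nz s'm).1].
  rewrite kv nk last2Dl// !last2Zl// kv /=; ring.
- rewrite -[l in LHS]/(cst l y) last2_nabla //; [|exact: dk|by move=> z s' Nz s'm; exact: (Bk _ _ _ Nz s'm).2].
  rewrite vk nk last2Dr// !last2Zr// vk /=; ring.
- rewrite -{1 2}Wy last2_nabla //; [|exact: dW|exact: dW|by move=> z s' Nz s'm; apply: Bp; auto].
  rewrite nW Wy !(last2Dl, last2Dr, last2Zl, last2Zr)// kv vk mm; ring.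
Qed.

Lemma lead_geN1 j (B : tensor_field j.+2) s : size s = j -> differentiable_on B ->
  vanish_geN1 B ->
  last2 (nabla G B y : tensor j.+3) (X :: s) m l = beta * last2 (B y) s l l /\
  last2 (nabla G B y : tensor j.+3) (X :: s) l m = beta * last2 (B y) s l l.
Proof.
move=> sj dB Bp; have [Wy dW pW _ [b [c nW]]] := rot.
have dl : differentiable (cst l : 'rV[R]_3 -> 'rV[R]_3) y by exact: differentiable_cst.
have kv v := Bp _ _ _ v Ny sj (perp_k Ny); have mv v := Bp _ _ _ v Ny sj pm.
split; rewrite -{1}Wy -{1}[l in LHS]/(cst l y) last2_nabla //; first [exact: dW | idtac].
- rewrite nW Wy !(last2Dl, last2Zl)// (kv _).1 !(mv _).1 /=; ring.
- by move=> z s' Nz s'm; exact: (Bp _ _ _ _ Nz s'm (pW z Nz)).1.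
- rewrite nW Wy !(last2Dr, last2Zr)// (kv _).2 !(mv _).2 /=; ring.
- by move=> z s' Nz s'm; exact: (Bp _ _ _ _ Nz s'm (pW z Nz)).2.
Qed.

(** The two components of weight 1 force [B (k, l) = B (l, k) = B (m, m)], and
    the trace is the sum of these three numbers. *)
Lemma stage_pos (B : tensor_field 2) : differentiable_on B -> vanish_pos B -> beta != 0 ->
  last2 (B y) [::] (k y) l + last2 (B y) [::] l (k y) + last2 (B y) [::] m m = 0 ->
  last2 (nabla G B y : tensor 3) [:: X] (k y) m = 0 ->
  last2 (nabla G B y : tensor 3) [:: X] m (k y) = 0 ->
  [/\ last2 (B y) [::] (k y) l = 0, last2 (B y) [::] l (k y) = 0 & last2 (B y) [::] m m = 0].
Proof.
move=> dB Bp b0 tr.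
have [-> ->] := @lead_pos 0 B [::] erefl dB Bp.
move=> /eqP; rewrite mulf_eq0 (negbTE b0) /= => /eqP h1.
move=> /eqP; rewrite mulf_eq0 (negbTE b0) /= => /eqP h2.
split; lra.
Qed.

(** Up to sign the two components of weight 1 of the second derivative are
    [beta ^+ 2] times [B (l, m) + 2 B (m, l)] and [2 B (l, m) + B (m, l)]. *)
Lemma stage_nonneg (B : tensor_field 2) : differentiable_on B -> differentiable_on (nabla G B) ->
  vanish_nonneg B -> beta != 0 ->
  last2 (nabla G (nabla G B) y : tensor 4) [:: X; X] (k y) m = 0 ->
  last2 (nabla G (nabla G B) y : tensor 4) [:: X; X] m (k y) = 0 ->
  last2 (B y) [::] l m = 0 /\ last2 (B y) [::] m l = 0.
Proof.
move=> dB dB1 Bp b0.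
have [-> ->] := @lead_pos 1 (nabla G B) [:: X] erefl dB1 (vanish_pos_nabla dB Bp).
have [-> -> ->] := @lead_nonneg 0 B [::] erefl dB Bp.
move=> /eqP; rewrite -mulrN -mulrBr !mulf_eq0 (negbTE b0) /= => /eqP h1.
move=> /eqP; rewrite -mulrN -mulrBr !mulf_eq0 (negbTE b0) /= => /eqP h2.
split; lra.
Qed.

(** The component [(k, m)] of the third derivative is
    [- 3 beta ^+ 3 B (l, l)]. *)
Lemma stage_geN1 (B : tensor_field 2) : differentiable_on B -> differentiable_on (nabla G B) ->
  differentiable_on (nabla G (nabla G B)) ->
  vanish_geN1 B -> beta != 0 ->
  last2 (nabla G (nabla G (nabla G B)) y : tensor 5) [:: X; X; X] (k y) m = 0 ->
  last2 (B y) [::] l l = 0.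
Proof.
move=> dB dB1 dB2 Bp b0.
have B1 := vanish_nonneg_nabla dB Bp.
have [-> _] := @lead_pos 2 (nabla G (nabla G B)) [:: X; X] erefl dB2 (vanish_pos_nabla dB1 B1).
have [-> _ ->] := @lead_nonneg 1 (nabla G B) [:: X] erefl dB1 B1.
have [-> ->] := @lead_geN1 0 B [::] erefl dB Bp.
rewrite -mulrN -mulrBr => /eqP; rewrite !mulf_eq0 (negbTE b0) /= => /eqP h.
have : beta * last2 (B y) [::] l l = 0 by lra.
by move=> /eqP; rewrite mulf_eq0 (negbTE b0) => /eqP.
Qed.

End Filtration.

(** * Null frames in dimension three *)

Local Notation i0 := (@Ordinal 3 0 isT).
Local Notation i1 := (@Ordinal 3 1 isT).
Local Notation i2 := (@Ordinal 3 2 isT).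

Section Frames.
Context {R : realType}.
Implicit Types (A e : 'M[R]_3) (u v w : 'rV[R]_3).

Lemma big_ord3 (V : nmodType) (F : 'I_3 -> V) : \sum_i F i = F i0 + F i1 + F i2.
Proof.
rewrite !big_ord_recl big_ord0 addr0 addrA.
by congr (_ + _ + _); congr F; exact: val_inj.
Qed.

Lemma ord3P (P : 'I_3 -> Prop) : P i0 -> P i1 -> P i2 -> forall i, P i.
Proof.
move=> P0 P1 P2 [[|[|[|//]]] h]; [move: P0|move: P1|move: P2];
  by congr P; exact: val_inj.
Qed.

Lemma lorentzian_sym A : lorentzian A -> A^T = A.
Proof.
case=> P uP PAP; have sM : (Defs.minkowski : 'M[R]_3)^T = Defs.minkowski.
  by apply/matrixP => i j; rewrite !mxE eq_sym; case: eqP => // ->.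
have : P *m A^T *m P^T = P *m A *m P^T.
  by rewrite PAP -[RHS]sM -PAP !trmx_mul trmxK mulmxA.
by move/(can_inj (mulmxK _)) => /(_ _)/(can_inj (mulKmx uP)); apply; rewrite unitmx_tr.
Qed.

Lemma lorentzian_unit A : lorentzian A -> A \in unitmx.
Proof.
case=> P uP PAP; have mm : (Defs.minkowski : 'M[R]_3) *m Defs.minkowski = 1%:M.
  by apply/matrixP; apply: ord3P; apply: ord3P; rewrite !mxE big_ord3 !mxE /=; ring.
have : P *m (A *m (P^T *m Defs.minkowski)) = 1%:M by rewrite !mulmxA PAP.
move/mulmx1C; rewrite -!mulmxA => /mulmx1_unit[]; by [].
Qed.

Lemma null_frame_inner A e i j : null_frame A e ->
  inner A (row i e) (row j e) = null_gram i j.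
Proof. by move=> <-; rewrite /inner -row_mul mxE [RHS]mxE; apply: eq_bigr => a _; rewrite !mxE. Qed.

Lemma null_gramK : (null_gram : 'M[R]_3) *m null_gram = 1%:M.
Proof.
by apply/matrixP; apply: ord3P; apply: ord3P; rewrite !mxE big_ord3 !mxE /=; ring.
Qed.

Lemma null_frame_unit A e : null_frame A e -> e \in unitmx.
Proof.
move=> eA; have : e *m (A *m e^T *m null_gram) = 1%:M by rewrite !mulmxA eA null_gramK.
by case/mulmx1_unit.
Qed.

Lemma null_frame_decomp A e v : null_frame A e ->
  v = inner A v (row i1 e) *: row i0 e + inner A v (row i2 e) *: row i2 e
      + inner A v (row i0 e) *: row i1 e.
Proof.
move=> fe; have ue := null_frame_unit fe.
have -> : v = (v *m invmx e) *m e by rewrite mulmxKV.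
rewrite mulmx_sum_row big_ord3 !(innerDl, innerZl, null_frame_inner _ _ fe) !mxE /=.
rewrite !(mulr0, mulr1, add0r, addr0) addrAC.
by [].
Qed.

(** In an orthonormal basis a null vector is [(c0, c1, c2)] with
    [c0 ^+ 2 = c1 ^+ 2 + c2 ^+ 2]. Reversing time and rescaling gives [l], and
    the spatial part rotated by a right angle gives [m]. *)
Lemma null_frame_exists A v : lorentzian A -> v != 0 -> inner A v v = 0 ->
  exists2 e, null_frame A e & row i0 e = v.
Proof.
case=> P uP PAP v0 vv.
have [c vP] : exists c, v = c *m P by exists (v *m invmx P); rewrite mulmxKV.
have cc : c 0 i0 ^+ 2 = c 0 i1 ^+ 2 + c 0 i2 ^+ 2.
  move: vv; rewrite /inner vP trmx_mul !mulmxA -(mulmxA c) -(mulmxA c) PAP.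
  rewrite mxE big_ord3 !mxE !big_ord3 !mxE /= => H; apply/eqP; rewrite -subr_eq0 -oppr_eq0.
  by apply/eqP; rewrite -[RHS]H; ring.
have c0 : c 0 i0 != 0.
  apply: contra v0 => /eqP c0; rewrite vP.
  have := cc; rewrite c0 expr0n /= => /esym/eqP.
  rewrite paddr_eq0 ?sqr_ge0// !sqrf_eq0 => /andP[/eqP c1 /eqP c2].
  rewrite (_ : c = 0) ?mul0mx//; apply/rowP; apply: ord3P; by rewrite mxE.
pose E : 'M[R]_3 := \matrix_(i, j)
  if i == i0 then c 0 j
  else if i == i1 then (if j == i0 then - c 0 j else c 0 j) / (2 * c 0 i0 ^+ 2)
  else if j == i0 then 0 else if j == i1 then - c 0 i2 / c 0 i0 else c 0 i1 / c 0 i0.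
exists (E *m P); last first.
  by rewrite vP row_mul; congr (_ *m _); apply/rowP => j; rewrite !mxE.
rewrite /null_frame trmx_mul !mulmxA -(mulmxA E) -(mulmxA E) PAP.
apply/matrixP; apply: ord3P; apply: ord3P; rewrite !mxE !big_ord3 !mxE !big_ord3 !mxE /=;
  move: (c 0 i0) (c 0 i1) (c 0 i2) cc c0 => c0 c1 c2 cc c0_neq0; by field: cc.
Qed.

(** The inverse metric is [e^T *m null_gram *m e], as [null_gram] is an
    involution. *)
Lemma trace_null_frame A e (T : @tensor R 3 2) : null_frame A e -> A \in unitmx ->
  \sum_a \sum_b invmx A a b * T [tuple a; b] =
  last2 T [::] (row i0 e) (row i1 e) + last2 T [::] (row i1 e) (row i0 e)
  + last2 T [::] (row i2 e) (row i2 e).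
Proof.
move=> fe uA; have ue := null_frame_unit fe.
pose S : 'M[R]_3 := \matrix_(a, b) T [tuple a; b].
have SE i j : last2 T [::] (row i e) (row j e) = (e *m S *m e^T) i j.
  rewrite /last2 cat0s tensor_eval2 mxE exchange_big; apply: eq_bigr => b _.
  rewrite !mxE mulr_suml; apply: eq_bigr => a _; rewrite !mxE; ring.
have -> : \sum_a \sum_b invmx A a b * T [tuple a; b] = \tr (invmx A *m S^T).
  apply: eq_bigr => a _; rewrite mxE; apply: eq_bigr => b _; by rewrite !mxE.
have -> : invmx A = e^T *m null_gram *m e.
  have H : A *m (e^T *m null_gram *m e) = 1%:M.
    have /mulmx1C : e *m (A *m e^T *m null_gram) = 1%:M by rewrite !mulmxA fe null_gramK.
    by rewrite !mulmxA.
  by rewrite -[LHS]mulmx1 -H mulKmx.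
rewrite -!mulmxA mxtrace_mulC -!mulmxA /mxtrace !SE.
have -> : (e *m (S^T *m e^T)) = (e *m S *m e^T)^T by rewrite !trmx_mul trmxK.
move: (e *m S *m e^T) => Q.
rewrite big_ord3 !mxE !big_ord3 !mxE /=; ring.
Qed.

Lemma scalar_tracefree (G : 'rV[R]_3 -> 'M[R]_3) x : (G x)^T = G x -> G x \in unitmx ->
  \sum_a \sum_b invmx (G x) a b * tracefree_ricci G x [tuple a; b] = 0.
Proof.
move=> sG uG; rewrite /tracefree_ricci /=.
have tr3 : \sum_a \sum_b invmx (G x) a b * G x a b = 3.
  rewrite -(mxtrace1 R 3) -(mulVmx uG); apply: eq_bigr => a _; rewrite mxE.
  by apply: eq_bigr => b _; congr (_ * _); rewrite -[in LHS]sG mxE.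
under eq_bigr do under eq_bigr do rewrite mulrBr mulrCA.
under eq_bigr do rewrite sumrB -mulr_sumr.
rewrite sumrB -mulr_sumr tr3 -/(scalar_curvature G x).
by rewrite divfK ?subrr// pnatr_eq0.
Qed.
End Frames.

(** * Smoothness of the curvature tensors *)

Section SmoothTensors.
Context {R : realType} {n : nat} (G : 'rV[R]_n -> 'M[R]_n) (U : set 'rV[R]_n).
Context (oU : open U) (sG : smooth_on U G) (uG : forall x, U x -> G x \in unitmx).

Definition smooth_tensor r (T : @tensor_field R n r) :=
  forall al, smooth_on U (fun x => T x al).

Lemma smooth_christoffel c a b : smooth_on U (fun x => christoffel G x c a b).
Proof.
have sGe i j : smooth_on U (fun x => G x i j) by exact: smooth_entry.
apply: smooth_mul => //; first exact: smooth_cst.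
apply: smooth_sum => // d; apply: smooth_mul => //; first exact: smooth_invmx.
apply: smooth_add => //; last by apply: smooth_opp => //; exact: smooth_partial.
by apply: smooth_add => //; exact: smooth_partial.
Qed.

Lemma smooth_ricci a b : smooth_on U (fun x => ricci G x a b).
Proof.
have -> : (fun x => ricci G x a b) = fun x => \sum_d riemann G x d a d b.
  by apply/funext => x; rewrite mxE.
have sC := smooth_christoffel; apply: smooth_sum => // d.
apply: smooth_add => //; last first.
  apply: smooth_sum => // e; apply: smooth_add => //; first exact: smooth_mul.
  by apply: smooth_opp => //; exact: smooth_mul.
apply: smooth_add => //; first exact: smooth_partial.
by apply: smooth_opp => //; exact: smooth_partial.
Qed.

Lemma smooth_tracefree_ricci : smooth_tensor (tracefree_ricci G).
Proof.
move=> al; have sR := smooth_ricci.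
apply: smooth_add => //; apply: smooth_opp => //; apply: smooth_mul => //; last exact: smooth_entry.
apply: smooth_mul => //; last exact: smooth_cst.
apply: smooth_sum => // a; apply: smooth_sum => // b.
by apply: smooth_mul => //; apply: smooth_invmx => // i j; exact: smooth_entry.
Qed.

Lemma smooth_nabla r (T : tensor_field r) : smooth_tensor T -> smooth_tensor (nabla G T).
Proof.
move=> sT al; apply: smooth_add => //; first exact: smooth_partial.
apply: smooth_opp => //; apply: smooth_sum => // j; apply: smooth_sum => // c.
by apply: smooth_mul => //; exact: smooth_christoffel.
Qed.

End SmoothTensors.

(** * A non-Kundt open set carries no aligned trace-free tensor *)

Section MovingFrame.
Context {R : realType} (G : 'rV[R]_3 -> 'M[R]_3) (N : set 'rV[R]_3)
  (k : 'rV[R]_3 -> 'rV[R]_3).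
Context (oN : open N) (lorG : forall y, N y -> lorentzian (G y))
  (dG : forall y, N y -> differentiable G y)
  (dk : forall y, N y -> differentiable k y)
  (k0 : forall y, N y -> k y != 0)
  (knull : forall y, N y -> inner (G y) (k y) (k y) = 0).

Local Notation perp := (perp G k).

Let symG y : N y -> (G y)^T = G y. Proof. by move/lorG/lorentzian_sym. Qed.
Let uG y : N y -> G y \in unitmx. Proof. by move/lorG/lorentzian_unit. Qed.

Lemma exists_null_pairing y : N y -> exists l, inner (G y) (k y) l != 0.
Proof.
move=> Ny; have [e fe <-] := null_frame_exists (lorG Ny) (k0 Ny) (knull Ny).
by exists (row i1 e); rewrite (null_frame_inner _ _ fe) mxE /= oner_neq0.
Qed.

Lemma perp_decomp y e v : N y -> null_frame (G y) e -> row i0 e = k y -> perp y v ->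
  v = inner (G y) v (row i1 e) *: k y + inner (G y) v (row i2 e) *: row i2 e.
Proof.
move=> Ny fe e0 pv; rewrite {1}(null_frame_decomp v fe) e0.
by rewrite (innerC v (k y)) ?symG// pv scale0r addr0.
Qed.

Lemma nabla_vec_lin y a X Y : N y ->
  nabla_vec G k y (a *: X + Y) = a *: nabla_vec G k y X + nabla_vec G k y Y.
Proof.
move=> Ny; rewrite /nabla_vec !deriveE; try exact: dk.
rewrite linearP scalerDr addrACA; congr (_ + _); apply/rowP => b; rewrite !mxE.
rewrite mulr_sumr -big_split; apply: eq_bigr => i _.
rewrite mulr_sumr -big_split; apply: eq_bigr => c _ /=; rewrite !mxE; ring.
Qed.

(** Differentiating [g (W, k) = 0] along [X] identifies the [l]-component of
    [nabla_X W] as minus the [m]-component of [nabla_X k]. *)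
Lemma moving_frame y e X : N y -> null_frame (G y) e -> row i0 e = k y ->
  exists W, rotation G N k y (row i1 e) (row i2 e) X W (inner (G y) (nabla_vec G k y X) (row i2 e)).
Proof.
move=> Ny fe e0.
have pm : perp y (row i2 e) by rewrite /perp -e0 (null_frame_inner _ _ fe) mxE.
have [W [Wy dW pW]] := perp_extension dG dk exists_null_pairing Ny pm.
have pnk : perp y (nabla_vec G k y X) by exact: (perp_nabla_k oN symG uG dG dk knull).
exists W; split=> //; first by eexists; exact: perp_decomp pnk.
exists (inner (G y) (nabla_vec G W y X) (row i1 e)), (inner (G y) (nabla_vec G W y X) (row i2 e)).
rewrite {1}(null_frame_decomp (nabla_vec G W y X) fe) e0; congr (_ + _ *: _).
rewrite nabla_orthogonal //; try by [exact: dW|exact: dG|exact: dk|exact: uG].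
- by rewrite Wy innerC ?symG.
- exact: (near_N oN Ny symG).
- by apply: (near_N oN Ny) => z Nz; rewrite innerC ?symG//; exact: pW.
Qed.

(** The vectors [k] and [m] span the plane orthogonal to [k], and boost weights
    are only known for these two, so the failure of the Kundt property has to
    be witnessed by one of them. *)
Lemma non_kundt_frame y X w e : N y -> null_frame (G y) e -> row i0 e = k y ->
  perp y X -> perp y w -> inner (G y) (nabla_vec G k y X) w != 0 ->
  exists2 Z, Z = row i0 e \/ Z = row i2 e & inner (G y) (nabla_vec G k y Z) (row i2 e) != 0.
Proof.
move=> Ny fe e0 pX pw.
have pnk Z : inner (G y) (nabla_vec G k y Z) (k y) = 0.
  rewrite innerC ?symG//; exact: (perp_nabla_k oN symG uG dG dk knull).
rewrite (perp_decomp Ny fe e0 pw) innerDr !innerZr pnk mulr0 add0r mulf_eq0 negb_or => /andP[_].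
rewrite (perp_decomp Ny fe e0 pX) -[_ *: row i2 e]addr0 !nabla_vec_lin// -e0.
case: (eqVneq (inner (G y) (nabla_vec G k y (row i0 e)) (row i2 e)) 0) => [b0|];
  last by exists (row i0 e); [left|].
case: (eqVneq (inner (G y) (nabla_vec G k y (row i2 e)) (row i2 e)) 0) => [b2|];
  last by exists (row i2 e); [right|].
have nz : nabla_vec G k y 0 = 0.
  by have := nabla_vec_lin (-1) 0 0 Ny; rewrite scaler0 addr0 scaleN1r addNr.
by rewrite nz addr0 innerDl !innerZl b0 b2 !mulr0 addr0 eqxx.
Qed.

Context (T : @tensor_field R 3 2).
Let T1 : @tensor_field R 3 3 := nabla G T.
Let T2 : @tensor_field R 3 4 := nabla G T1.
Let T3 : @tensor_field R 3 5 := nabla G T2.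
Context (dT : differentiable_on N T) (dT1 : differentiable_on N T1)
  (dT2 : differentiable_on N T2).
Context (trT : forall y, N y -> \sum_a \sum_b invmx (G y) a b * T y [tuple a; b] = 0).
Context (nk : forall y, N y -> exists X w,
  [/\ perp y X, perp y w & inner (G y) (nabla_vec G k y X) w != 0]).

(** With [X] equal to [k] or [m] the boost weight of [(X, .., X, k, m)] is
    [j + 1] or [1], hence positive: these are the consequences of alignment
    that the argument consumes. *)
Definition frame_vanish j (B : @tensor_field R 3 j.+2) := forall y e X, N y ->
  null_frame (G y) e -> row i0 e = k y -> X = row i0 e \/ X = row i2 e ->
  last2 (B y) (nseq j X) (k y) (row i2 e) = 0 /\ last2 (B y) (nseq j X) (row i2 e) (k y) = 0.

Context (Tkk : forall y, N y -> last2 (T y) [::] (k y) (k y) = 0).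
Context (v0 : frame_vanish (j := 0) T) (v1 : frame_vanish (j := 1) T1)
  (v2 : frame_vanish (j := 2) T2) (v3 : frame_vanish (j := 3) T3).

Lemma adapted_frame y : N y -> exists e X W beta,
  [/\ null_frame (G y) e, row i0 e = k y, X = row i0 e \/ X = row i2 e, beta != 0 &
    rotation G N k y (row i1 e) (row i2 e) X W beta].
Proof.
move=> Ny; have [e fe e0] := null_frame_exists (lorG Ny) (k0 Ny) (knull Ny).
have [X [w [pX pw Xw]]] := nk Ny.
have [Z Zk Z0] := non_kundt_frame Ny fe e0 pX pw Xw.
have [W rW] := moving_frame Z Ny fe e0.
by exists e, Z, W; eexists; split; last exact: rW.
Qed.

Let pos : vanish_pos G N k (m := 0) T.
Proof.
move=> y [|//] u Ny _ pu.
have [e fe e0] := null_frame_exists (lorG Ny) (k0 Ny) (knull Ny).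
have [km mk] := v0 Ny fe e0 (or_introl erefl).
rewrite (perp_decomp Ny fe e0 pu) !last2Dr// !last2Dl// !last2Zr// !last2Zl//.
by rewrite Tkk// km mk !mulr0 addr0.
Qed.

Let nonneg : vanish_nonneg G N k (m := 0) T.
Proof.
have H y : N y -> exists e, [/\ null_frame (G y) e, row i0 e = k y &
  [/\ last2 (T y) [::] (k y) (row i1 e) = 0, last2 (T y) [::] (row i1 e) (k y) = 0
   & last2 (T y) [::] (row i2 e) (row i2 e) = 0]].
  move=> Ny; have [e [X [W [beta [fe e0 Xe b0 rW]]]]] := adapted_frame Ny.
  exists e; split=> //; have [km mk] := v1 Ny fe e0 Xe.
  apply: (stage_pos oN dk knull Ny rW dT pos b0 _ km mk).
  by have := trT Ny; rewrite (trace_null_frame _ fe) ?uG// e0.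
split=> [y [|//] v Ny _|y [|//] u v Ny _ pu pv];
  have [e [fe e0 [kl lk mm]]] := H y Ny; have [km mk] := v0 Ny fe e0 (or_introl erefl).
  rewrite (null_frame_decomp v fe) e0 !(last2Dr, last2Dl, last2Zr, last2Zl)//.
  by rewrite kl lk km mk Tkk// !(mulr0, addr0).
rewrite (perp_decomp Ny fe e0 pu) (perp_decomp Ny fe e0 pv).
rewrite !(last2Dr, last2Dl, last2Zr, last2Zl)//.
by rewrite mm km mk Tkk// !(mulr0, addr0).
Qed.

Let geN1 : vanish_geN1 G N k (m := 0) T.
Proof.
have [Tk Tp] := nonneg.
move=> y [|//] u v Ny _ pu; have [e [X [W [beta [fe e0 Xe b0 rW]]]]] := adapted_frame Ny.
have [km mk] := v2 Ny fe e0 Xe.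
have [lm ml] := stage_nonneg oN symG uG dG dk knull exists_null_pairing Ny rW dT dT1 nonneg b0 km mk.
have pm : perp y (row i2 e) by rewrite /perp -e0 (null_frame_inner _ _ fe) mxE.
rewrite (perp_decomp Ny fe e0 pu) (null_frame_decomp v fe) e0.
rewrite !(last2Dr, last2Dl, last2Zr, last2Zl)//.
by rewrite !(Tk _ [::] _ Ny erefl).1 !(Tk _ [::] _ Ny erefl).2 lm ml
  (Tp _ [::] _ _ Ny erefl pm pm) !(mulr0, addr0).
Qed.

(** Once the components of weight 0, -1 and -2 have been removed in turn, the
    tensor vanishes on the whole frame. Each step needs the previous one on all
    of [N], because it differentiates the vanishing components. *)
Theorem not_kundt_tensor0 y al : N y -> T y al = 0.
Proof.
move=> Ny; have [e [X [W [beta [fe e0 Xe b0 rW]]]]] := adapted_frame Ny.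
have [km _] := v3 Ny fe e0 Xe.
have ll := stage_geN1 oN symG uG dG dk knull exists_null_pairing Ny rW dT dT1 dT2 geN1 b0 km.
have kv v := @geN1 y [::] _ v Ny erefl (knull Ny).
have pm : perp y (row i2 e) by rewrite /perp -e0 (null_frame_inner _ _ fe) mxE.
have mv v := @geN1 y [::] _ v Ny erefl pm.
have T0 u v : last2 (T y) [::] u v = 0.
  rewrite (null_frame_decomp u fe) (null_frame_decomp v fe) e0.
  rewrite !(last2Dr, last2Dl, last2Zr, last2Zl)//.
  by rewrite !(kv _).1 !(kv _).2 !(mv _).1 !(mv _).2 ll !(mulr0, addr0).
case/tupleP: al => a al; case/tupleP: al => b al.
rewrite -(T0 (delta_mx 0 a) (delta_mx 0 b)) /last2 cat0s tensor_eval2.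
rewrite (bigD1 a) //= (bigD1 b) //= !big1 ?addr0.
- rewrite !mxE !eqxx !mul1r; congr (T y _); apply: val_inj => /=; by rewrite (tuple0 al).
- by move=> i ia; rewrite big1 // => j _; rewrite !mxE (negbTE ia) !mul0r.
- by move=> i ib; rewrite !mxE (negbTE ib) andbF mulr0 mul0r.
Qed.

End MovingFrame.

(** * From charts to the manifold *)

Section BoostOrder.
Context {R : realType}.

Lemma boost_order_vanish n r (T : @tensor R n r) e (s : int) (al : r.-tuple 'I_n) :
  (boost_order T e <= s%:E)%E -> s < boost_weight al ->
  tensor_eval T [seq row i e | i <- al] = 0.
Proof.
move=> bo lt_s; rewrite -frame_component_eval; apply/eqP; apply: contraLR lt_s => Te.
rewrite -leNgt -lee_fin; apply: le_trans bo.
exact: (@le_bigmax_cond _ _ _ _ _ _ (fun al => (boost_weight al)%:E)).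
Qed.

Lemma differentiable_nabla_vec n (G : 'rV[R]_n -> 'M[R]_n) U (k Z : 'rV[R]_n -> 'rV[R]_n) x b :
  open U -> U x -> smooth_on U G -> (forall y, U y -> G y \in unitmx) ->
  smooth_on U k -> differentiable Z x ->
  differentiable (fun y => nabla_vec G k y (Z y) 0 b) x.
Proof.
move=> oU Ux sG uG sk dZ.
have dke c y : U y -> differentiable (fun y => k y 0 c) y.
  by move=> Uy; apply: (smooth_differentiable _ Uy); exact: smooth_entry.
have E : \forall y \near x, \sum_a Z y 0 a * partial a (fun y => k y 0 b) y
    + \sum_a \sum_c christoffel G y b a c * Z y 0 a * k y 0 c = nabla_vec G k y (Z y) 0 b.
  apply: filterS (open_nbhs_nbhs (conj oU Ux)) => y Uy.
  by rewrite nabla_vecE ?derive_partial; [|exact: dke|exact: smooth_differentiable sk Uy].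
apply: near_differentiable E _.
have dZe a : differentiable (fun y => Z y 0 a) x by exact: differentiable_entry.
apply: differentiableD; apply: differentiable_bigsum => a.
  apply: differentiableM => //; apply: (smooth_differentiable _ Ux).
  by apply: smooth_partial; exact: smooth_entry.
apply: differentiable_bigsum => c; apply: differentiableM; last exact: dke.
apply: differentiableM => //; apply: (smooth_differentiable _ Ux).
exact: smooth_christoffel.
Qed.

(** The vector [X] and the spacelike frame vector [m] at [x] extend to
    differentiable fields [Z] and [W] orthogonal to [k]; then
    [g (nabla_Z k, W)] is a continuous function that is non-zero at [x]. *)
Lemma not_kundt_open (G : 'rV[R]_3 -> 'M[R]_3) U (k : 'rV[R]_3 -> 'rV[R]_3) x X :
  open U -> U x -> smooth_on U G -> (forall y, U y -> lorentzian (G y)) ->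
  smooth_on U k -> (forall y, U y -> k y != 0) ->
  (forall y, U y -> inner (G y) (k y) (k y) = 0) ->
  perp G k x X -> ~ (exists t : R, nabla_vec G k x X = t *: k x) ->
  exists N, [/\ open N, N x, N `<=` U &
    forall y, N y -> exists Z w,
      [/\ perp G k y Z, perp G k y w & inner (G y) (nabla_vec G k y Z) w != 0]].
Proof.
move=> oU Ux sG lorG sk k0 knull pX nk.
have symG y : U y -> (G y)^T = G y by move/lorG/lorentzian_sym.
have uG y : U y -> G y \in unitmx by move/lorG/lorentzian_unit.
have dG y : U y -> differentiable G y by exact: smooth_differentiable sG.
have dk y : U y -> differentiable k y by exact: smooth_differentiable sk.
have kn0 := exists_null_pairing lorG k0 knull.
have [e fe e0] := null_frame_exists (lorG x Ux) (k0 x Ux) (knull x Ux).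
have pnk := perp_nabla_k oU symG uG dG dk knull X Ux.
have pm : perp G k x (row i2 e) by rewrite /perp -e0 (null_frame_inner _ _ fe) mxE.
have b0 : inner (G x) (nabla_vec G k x X) (row i2 e) != 0.
  apply/eqP => b0; apply: nk; eexists.
  by rewrite [LHS](perp_decomp lorG Ux fe e0 pnk) b0 scale0r addr0.
have [W [Wx dW pW]] := perp_extension dG dk kn0 Ux pm.
have [Z [Zx dZ pZ]] := perp_extension dG dk kn0 Ux pX.
pose f y := inner (G y) (nabla_vec G k y (Z y)) (W y).
have cf : {for x, continuous f}.
  apply: differentiable_continuous; apply: differentiable_inner; [exact: dG| |exact: dW].
  by move=> j; apply: (differentiable_nabla_vec _ oU) => //; exact: dZ.
have : nbhs x [set y | U y /\ f y != 0].
  apply: filterI; first exact: open_nbhs_nbhs.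
  by apply: cvgr_neq0 cf _; rewrite /f Zx Wx.
rewrite nbhsE => -[N [oN Nx] NUf]; exists N; split=> // [y /NUf[]//|y Ny].
have [Uy fy] := NUf y Ny.
by exists (Z y), (W y); split; [exact: pZ|exact: pW|].
Qed.

End BoostOrder.

Theorem theorem3 (R : realType) (M : manifold R 3) (g : lorentz_metric M)
    (c : null_congruence g)
    (hbo : forall m : nat, (m <= 3)%N ->
       forall p : M, boost_order_le c (nabla_tracefree_ricci g m) 0 p) :
  forall p : M,
    closure [set q : M | nonzero_at (nabla_tracefree_ricci g 0) q]%classic p ->
    kundt_at c p.
Proof.
move=> p clp i pi x U k oU Ux Uimg [sk kC] X pX.
pose G := lm_gram g i.
have sG : smooth_on U G by apply: (smooth_sub Uimg); exact: lm_smooth.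
have lorG y : U y -> lorentzian (G y) by move/Uimg; exact: lm_lorentzian.
have symG y : U y -> (G y)^T = G y by move/lorG/lorentzian_sym.
have uG y : U y -> G y \in unitmx by move/lorG/lorentzian_unit.
have k0 y : U y -> k y != 0 by case/kC.
have knull y : U y -> inner (G y) (k y) (k y) = 0.
  by move=> Uy; apply: nc_null (kC y Uy).2; exact: Uimg.
have perpX : perp G k x X by rewrite /perp innerC ?symG//; apply: pX; case: (kC x Ux).
apply: contrapT => nkx.
have [N [oN Nx NU NK]] := not_kundt_open oU Ux sG lorG sk k0 knull perpX nkx.
have dG y : U y -> differentiable G y by exact: smooth_differentiable sG.
have dk y : U y -> differentiable k y by exact: smooth_differentiable sk.
have S0 y al : N y -> tracefree_ricci G y al = 0.
  have sT := smooth_tracefree_ricci oU sG uG.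
  have sT1 := smooth_nabla oU sG uG sT.
  have sT2 := smooth_nabla oU sG uG sT1.
  have dN r (T : tensor_field r) : smooth_tensor U T -> differentiable_on N T.
    by move=> sT' z /NU Uz al'; exact: smooth_differentiable (sT' al') Uz.
  have bo z m e' (al' : (m + 2).-tuple 'I_3) : N z -> (m <= 3)%N -> null_frame (G z) e' ->
      row i0 e' = k z -> 0 < boost_weight al' ->
      tensor_eval (iter_nabla G (tracefree_ricci G) m z) [seq row j e' | j <- al'] = 0.
    move=> Nz m3 fe' e0'; apply: boost_order_vanish.
    have [q qi qz] := Uimg z (NU z Nz).
    rewrite -qz; apply: (hbo m m3 q i qi); rewrite qz// => j j0.
    have -> : j = i0 by exact: val_inj.
    by rewrite e0'; exact: (kC z (NU z Nz)).2.
  have NUP (P : 'rV[R]_3 -> Prop) : (forall y, U y -> P y) -> forall y, N y -> P y.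
    by move=> UP z /NU; exact: UP.
  apply: (not_kundt_tensor0 oN (NUP _ lorG) (NUP _ dG) (NUP _ dk) (NUP _ k0) (NUP _ knull)
     (dN _ _ sT) (dN _ _ sT1) (dN _ _ sT2)).
  - by move=> z /NU Uz; apply: scalar_tracefree; auto.
  - exact: NK.
  - move=> z Nz; have Uz := NU z Nz.
    have [e' fe' e0'] := null_frame_exists (lorG z Uz) (k0 z Uz) (knull z Uz).
    rewrite -e0'; exact: (bo z 0 e' [tuple i0; i0] Nz).
  - move=> z e' X' Nz fe' e0' _; rewrite -e0'; split.
      exact: (bo z 0 e' [tuple i0; i2] Nz).
    exact: (bo z 0 e' [tuple i2; i0] Nz).
  - move=> z e' X' Nz fe' e0' [] ->; rewrite -e0'; split.
    + exact: (bo z 1 e' [tuple i0; i0; i2] Nz).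
    + exact: (bo z 1 e' [tuple i0; i2; i0] Nz).
    + exact: (bo z 1 e' [tuple i2; i0; i2] Nz).
    + exact: (bo z 1 e' [tuple i2; i2; i0] Nz).
  - move=> z e' X' Nz fe' e0' [] ->; rewrite -e0'; split.
    + exact: (bo z 2 e' [tuple i0; i0; i0; i2] Nz).
    + exact: (bo z 2 e' [tuple i0; i0; i2; i0] Nz).
    + exact: (bo z 2 e' [tuple i2; i2; i0; i2] Nz).
    + exact: (bo z 2 e' [tuple i2; i2; i2; i0] Nz).
  - move=> z e' X' Nz fe' e0' [] ->; rewrite -e0'; split.
    + exact: (bo z 3 e' [tuple i0; i0; i0; i0; i2] Nz).
    + exact: (bo z 3 e' [tuple i0; i0; i0; i2; i0] Nz).
    + exact: (bo z 3 e' [tuple i2; i2; i2; i0; i2] Nz).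
    + exact: (bo z 3 e' [tuple i2; i2; i2; i2; i0] Nz).
have nbp : nbhs p (ch_dom (mf_chart i) `&` ch_map (mf_chart i) @^-1` N).
  apply: filterI; first by apply: open_nbhs_nbhs; split=> //; exact: ch_dom_open.
  by apply: (ch_map_cont pi); exact: open_nbhs_nbhs.
have [q [qS [qi qN]]] := clp _ nbp.
by have [al] := qS i qi; apply; exact: S0.
Qed.
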